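(* Let $N\ge 1$ be an integer, $\nu>0$, and $\sigma\ge\frac2N$. Consider the linearly damped discrete Klein-Gordon equation $$\ddot{\phi}_n+\nu\dot\phi_n-(\Delta_d\phi)_n-|\phi_n|^{2\sigma}\phi_n=0,\quad n\in\mathbb{Z}^N,\ t>0,\qquad \phi(0)=\phi_0,\quad\dot\phi(0)=\phi_1,$$ with $\phi_0,\phi_1\in\ell^2$. Let $$\mathcal{H}(0)=\frac12\|\phi_1\|_{\ell^2}^2+\frac12\sum_{\kappa=1}^N\|\nabla_\kappa^+\phi_0\|_{\ell^2}^2-\frac{1}{2\sigma+2}\sum_{n\in\mathbb{Z}^N}|\phi_{0,n}|^{2\sigma+2}$$ and $$\rho_0:=\frac2\nu\left\{\nu\|\phi_0\|_{\ell^2}^2+\frac6\nu\mathcal{H}(0)+2(\phi_0,\phi_1)_{\ell^2}\right\}.$$ Let $C_*>0$ be a constant such that $$\sum_{n\in\mathbb{Z}^N}|\phi_n|^{2\sigma+2}\le C_*\Big(\sum_{n\in\mathbb{Z}^N}|\phi_n|^2\Big)^{\sigma}\sum_{\kappa=1}^N\|\nabla_\kappa^+\phi\|_{\ell^2}^2\quad\text{for all }\phi\in\ell^2.$$ Assume that the initial data satisfy $$\rho_0<\frac{1}{C_*^{1/\sigma}}\qquad\text{and}\qquad\sum_{\kappa=1}^N\|\nabla_\kappa^+\phi_0\|_{\ell^2}^2>\|\phi_0\|_{\ell^{2\sigma+2}}^{2\sigma+2}.$$ Then the solution satisfies $\phi\in C^2([0,+\infty),\ell^2)$ and $\lim_{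t\to+\infty}\|\phi(t)\|_{\ell^2}=0$.
   Context: $\ell^p$ denotes the space of real sequences $\phi=\{\phi_n\}_{n\in\mathbb{Z}^N}$ with $\|\phi\|_{\ell^p}=(\sum_{n\in\mathbb{Z}^N}|\phi_n|^p)^{1/p}<\infty$; $\ell^2$ has scalar product $(\phi,\psi)_{\ell^2}=\sum_{n\in\mathbb{Z}^N}\phi_n\psi_n$. With $e_\kappa$ the $\kappa$-th standard unit vector of $\mathbb{Z}^N$, set $$(\nabla_\kappa^+\phi)_n=\phi_{n+e_\kappa}-\phi_n,\qquad (\Delta_d\phi)_n=\sum_{\kappa=1}^N\big(\phi_{n+e_\kappa}+\phi_{n-e_\kappa}-2\phi_n\big).$$ A constant $C_*$ as in the claim exists for every $\sigma\ge 2/N$ (a known discrete Sobolev-Gagliardo-Nirenberg inequality due to Weinstein). For every $(\phi_0,\phi_1)\in\ell^2\times\ell^2$ the initial value problem has a unique maximal solution $(\phi,\dot\phi)$, continuous in time with values in $\ell^2\times\ell^2$; ''the solution'' refers to this maximal solution. *)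

(* Defs.v *)
From mathcomp Require Import all_boot all_order all_algebra.
From mathcomp Require Import all_classical all_reals all_analysis.

Set Implicit Arguments.
Unset Strict Implicit.
Unset Printing Implicit Defensive.

Import Order.TTheory GRing.Theory Num.Theory.
Import numFieldNormedType.Exports.

Local Open Scope classical_set_scope.
Local Open Scope ring_scope.

Section SequenceSpaces.
Context {R : realType} {N : nat}.
Implicit Types (phi psi : 'rV[int]_N -> R) (p : R).

(* Unordered sum over Z^N, computed as (sum of positive parts) - (sum of
   negative parts). It is the usual sum for absolutely summable families and
   has no meaning otherwise. *)
Definition lsum (f : 'rV[int]_N -> R) : R :=
  fine (esum [set: 'rV[int]_N] (EFin \o f)^\+
        - esum [set: 'rV[int]_N] (EFin \o f)^\-)%E.

Definition lp p : set ('rV[int]_N -> R) :=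
  [set phi | summable [set: 'rV[int]_N] (fun n => (`|phi n| `^ p)%:E)].

(* Meaningful for phi in lp p and p > 0 only. *)
Definition lpnorm p phi : R := lsum (fun n => `|phi n| `^ p) `^ p^-1.

Definition l2norm phi : R := lpnorm 2 phi.

Definition l2dot phi psi : R := lsum (fun n => phi n * psi n).

Definition unit_vec (k : 'I_N) : 'rV[int]_N := delta_mx 0 k.

Definition fdiff (k : 'I_N) phi : 'rV[int]_N -> R :=
  fun n => phi (n + unit_vec k) - phi n.

Definition dlap phi : 'rV[int]_N -> R :=
  fun n => \sum_(k < N) (phi (n + unit_vec k) + phi (n - unit_vec k)
                         - 2 * phi n).

Definition grad_normsq phi : R := \sum_(k < N) l2norm (fdiff k phi) ^+ 2.

End SequenceSpaces.

(* Calculus of curves u : R -> l^2 restricted to a set D of times: values of u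
   outside D are irrelevant, and limits at a boundary point of D are
   one-sided. *)
Section Curves.
Context {R : realType} {N : nat}.
Implicit Types (D : set R) (u v : R -> 'rV[int]_N -> R).

Definition l2_valued D u := forall t, D t -> lp 2 (u t).

Definition l2_cont D u :=
  l2_valued D u /\
  forall t, D t -> l2norm (u s - u t) @[s --> within D (nbhs t)] --> (0 : R).

Definition l2_deriv D u v :=
  [/\ l2_valued D u, l2_valued D v
    & forall t, D t ->
        l2norm ((s - t)^-1 *: (u s - u t) - v t) @[s --> within D t^']
          --> (0 : R)].

Definition l2_C2 D u :=
  exists u' u'', [/\ l2_deriv D u u', l2_deriv D u' u'',
                     l2_cont D u, l2_cont D u' & l2_cont D u''].

End Curves.

Section KleinGordon.
Context {R : realType} {N : nat}.
Variables (nu sigma : R) (phi0 phi1 : 'rV[int]_N -> R).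

Definition energy0 : R :=
  2^-1 * l2norm phi1 ^+ 2 + 2^-1 * grad_normsq phi0
  - (2 * sigma + 2)^-1 * lsum (fun n => `|phi0 n| `^ (2 * sigma + 2)).

Definition rho0 : R :=
  2 / nu * (nu * l2norm phi0 ^+ 2 + 6 / nu * energy0 + 2 * l2dot phi0 phi1).

(* The life span T lies in ]0, +oo]. *)
Definition lifetime (T : \bar R) : set R := [set t | 0 <= t /\ (t%:E < T)%E].

Definition dKG_solution (T : \bar R) (phi phid : R -> 'rV[int]_N -> R) :=
  [/\ (0 < T)%E,
      l2_cont (lifetime T) phi /\ l2_cont (lifetime T) phid,
      phi 0 = phi0 /\ phid 0 = phi1
    & forall (t : R) n, 0 < t -> (t%:E < T)%E ->
        is_derive t (1 : R) (phi ^~ n) (phid t n) /\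
        exists a : R, is_derive t (1 : R) (phid ^~ n) a /\
          a + nu * phid t n - dlap (phi t) n
            - `|phi t n| `^ (2 * sigma) * phi t n = 0].

Definition dKG_maximal_solution (T : \bar R)
    (phi phid : R -> 'rV[int]_N -> R) :=
  dKG_solution T phi phid /\
  forall T' psi psid, dKG_solution T' psi psid ->
    (forall t, lifetime T t -> lifetime T' t ->
       psi t = phi t /\ psid t = phid t) ->
    (T' <= T)%E.

End KleinGordon.

(* Main.v *)
(* Let H be the energy, I = |grad phi|^2 - sum |phi|^(2 sigma + 2) and
   F = nu/2 |phi|^2 + (phi, phi') + 3/nu H.  Along a solution
   F' = - 2 |phi'|^2 - I, and rho0 = 4/nu F(0).  As long as
   C |phi|^(2 sigma) < 1, the Gagliardo-Nirenberg inequality gives I >= 0, so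
   that F decreases and F >= nu/4 |phi|^2, whence |phi|^2 <= rho0: by
   continuity this bound never fails.  Therefore the solution of the equation
   with the nonlinearity truncated at a suitable height, which is global by
   Picard iteration, solves the original equation.  It coincides with phi by
   Gronwall's lemma, and the life span is infinite by maximality.

   For the decay, F' <= - c e with e = |phi'|^2 + |grad phi|^2, which together
   with the monotonicity of H yields e = O(1/t).  There is no Poincare
   inequality on the lattice, so the low frequencies are handled with the mean
   Q phi of m translates of phi in one direction.  The growth of
   M = nu/2 |Q phi|^2 + (Q phi, Q phi') is at most 2/c times the decrease of F,
   uniformly in m.  When t tends to infinity with m fixed, F - M tends to 0,
   since |phi - Q phi| <= m |grad phi|; when m tends to infinity with the time
   fixed, M tends to 0.  Hence the limit of F is 0. *)

Require Import Defs.
From HB Require Import structures.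
From mathcomp Require Import all_boot all_order all_algebra finmap.
From mathcomp Require Import all_classical all_reals all_analysis.
From mathcomp Require Import ring lra.
Set Implicit Arguments.
Unset Strict Implicit.
Unset Printing Implicit Defensive.
Import Order.TTheory GRing.Theory Num.Theory.
Import numFieldNormedType.Exports.
Local Open Scope classical_set_scope.
Local Open Scope ring_scope.

(** * Unordered sums *)

Section UnorderedSums.
Context {R : realType}.
Implicit Types (T : choiceType).

(** The equation is given site by site, while energy identities need derivatives in the norm of l^2.
    Since each coordinate is bounded by the norm, the right-hand side is continuous from l^2 to l^2,
    and a mean value estimate over finite sets of sites turns coordinatewise derivatives with
    l^2-continuous velocity into derivatives in norm. The assumption I(phi0) > 0 starts the
    continuity argument: it gives |phi0|^2 <= rho0, a bound that is nowhere assumed. The strict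
    inequality on rho0 serves twice: it keeps the orbit where the truncation is inactive, and it
    leaves the margin c = 1 - C rho0^sigma > 0, for which I >= c |grad phi|^2. The dissipation of F
    sees |phi'| and |grad phi| but not |phi|. The mean Q is a low-pass filter adapted to the
    nonlinearity: it commutes with the Laplacian, contracts the norm, and the pairing of Q phi with
    the mean of |phi|^(2 sigma) phi is bounded by Young's inequality between translates, with no
    loss in m. The order of choices is decisive: a time where F almost attains its infimum, then m,
    then a later time depending on m. *)

Definition summ T (f : T -> R) := summable setT (EFin \o f).

(** Has the body of [lsum], so that the sums of the statement are instances of it by conversion. *)
Definition tsum T (f : T -> R) : R :=
  fine (esum setT (EFin \o f)^\+ - esum setT (EFin \o f)^\-)%E.

Lemma esum_le_fset T (f : T -> R) (K : R) :
  (forall A : {fset T}, \sum_(x <- A) f x <= K) ->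
  (esum setT (EFin \o f) <= K%:E)%E.
Proof.
move=> h; apply: ge_ereal_sup => /= _ [A [finA _] <-].
by rewrite fsbig_finite//= sumEFin lee_fin.
Qed.

Lemma fset_le_esum T (f : T -> R) (A : {fset T}) :
  ((\sum_(x <- A) f x)%:E <= esum setT (EFin \o f))%E.
Proof.
apply: esum_ge; exists [set` A]; first by split => //; exact: finite_fset.
by rewrite fsbig_finite//= ?set_fsetK ?sumEFin//; exact: finite_fset.
Qed.

Lemma summ_ub T (f : T -> R) (K : R) :
  (forall A : {fset T}, \sum_(x <- A) `|f x| <= K) -> summ f.
Proof.
move=> /esum_le_fset h; rewrite /summ /summable.
by apply: le_lt_trans (ltry K); apply: le_trans h; apply: le_esum.
Qed.

Lemma summ_le T (f g : T -> R) :
  (forall x, `|f x| <= g x) -> summ g -> summ f.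
Proof.
move=> fg; apply: le_lt_trans; apply: le_esum => x _ /=.
by rewrite lee_fin (le_trans (fg x))// ler_norm.
Qed.

Lemma summD T (f g : T -> R) : summ f -> summ g -> summ (fun x => f x + g x).
Proof. exact: summableD. Qed.

Lemma summN T (f : T -> R) : summ f -> summ (fun x => - f x).
Proof. by rewrite /summ summableN. Qed.

Lemma summB T (f g : T -> R) : summ f -> summ g -> summ (fun x => f x - g x).
Proof. by move=> sf sg; apply: summD => //; exact: summN. Qed.

Lemma summ_norm T (f : T -> R) : summ f -> summ (fun x => `|f x|).
Proof.
by apply: le_lt_trans; apply: le_esum => x _ /=; rewrite normr_id.
Qed.

Lemma esum_fin T (f : T -> R) : (forall x, 0 <= f x) -> summ f ->
  esum setT (EFin \o f) \is a fin_num.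
Proof.
move=> f0; rewrite /summ summableE; congr (_ \is a fin_num).
by apply: eq_esum => x _ /=; rewrite ger0_norm.
Qed.

Lemma tsum_ge0E T (f : T -> R) : (forall x, 0 <= f x) ->
  tsum f = fine (esum setT (EFin \o f)).
Proof.
move=> f0; rewrite /tsum [X in (_ - X)%E](_ : _ = 0%E) ?sube0.
  congr fine; apply: eq_esum => x _; rewrite funeposE; apply/max_idPl.
  by rewrite /= lee_fin.
by rewrite esum1// => x _; rewrite funenegE; apply/max_idPr;
  rewrite /= lee_fin oppr_le0.
Qed.

Lemma EFin_tsum T (f : T -> R) : (forall x, 0 <= f x) -> summ f ->
  (tsum f)%:E = esum setT (EFin \o f).
Proof. by move=> f0 sf; rewrite tsum_ge0E// fineK// esum_fin. Qed.

Lemma tsum_ge0B T (f g : T -> R) : (forall x, 0 <= f x) -> (forall x, 0 <= g x) ->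
  summ f -> summ g -> tsum (fun x => f x - g x) = tsum f - tsum g.
Proof.
move=> f0 g0 sf sg; rewrite /tsum; apply: EFin_inj.
have -> : (EFin \o (fun x => f x - g x)) = ((EFin \o f) \- (EFin \o g))%E by [].
rewrite esumB//; try by move=> x _; rewrite /= lee_fin.
by rewrite fineK ?fin_numB ?esum_fin// -!EFin_tsum// -?EFinB//.
Qed.

Lemma tsum_ge0D T (f g : T -> R) : (forall x, 0 <= f x) -> (forall x, 0 <= g x) ->
  summ f -> summ g -> tsum (fun x => f x + g x) = tsum f + tsum g.
Proof.
move=> f0 g0 sf sg; apply: EFin_inj; rewrite EFinD !EFin_tsum//.
- by rewrite -esumD//; move=> x _; rewrite /= lee_fin.
- by move=> x; rewrite addr_ge0.
- exact: summD.
Qed.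

Let pos (f : R) : R := Num.max f 0.
Let neg (f : R) : R := Num.max (- f) 0.

Lemma tsum_pn T (f : T -> R) : summ f ->
  [/\ summ (pos \o f), summ (neg \o f),
   f = (fun x => pos (f x) - neg (f x)) &
   tsum f = tsum (pos \o f) - tsum (neg \o f)].
Proof.
move=> sf.
have sp : summ (pos \o f).
  apply: summ_le (summ_norm sf) => x /=.
  by rewrite /pos; case: (lerP (f x) 0) => h; rewrite ?normr0 ?normr_ge0.
have sn : summ (neg \o f).
  apply: summ_le (summ_norm sf) => x /=.
  by rewrite /neg; case: (lerP (- f x) 0) => h; rewrite ?normr0 ?normr_ge0 ?normrN.
have fE : f = (fun x => pos (f x) - neg (f x)).
  apply/funext => x; rewrite /pos /neg; case: (lerP (f x) 0) => h.
    by rewrite sub0r max_l ?oppr_ge0// opprK.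
  by rewrite max_r ?subr0// oppr_le0 ltW.
split => //; rewrite {1}fE tsum_ge0B// => x /=;
  by rewrite /pos /neg le_max lexx orbT.
Qed.

Lemma tsumD T (f g : T -> R) : summ f -> summ g ->
  tsum (fun x => f x + g x) = tsum f + tsum g.
Proof.
move=> sf sg; have [sfp sfn fE ->] := tsum_pn sf; have [sgp sgn gE ->] := tsum_pn sg.
have p0 a : 0 <= pos a by rewrite /pos le_max lexx orbT.
have n0 a : 0 <= neg a by rewrite /neg le_max lexx orbT.
(* Positive parts are not additive: the sum is regrouped as a difference of two nonnegative
   families, which in general are not its positive and negative parts. *)
transitivity (tsum (fun x => (pos (f x) + pos (g x)) - (neg (f x) + neg (g x)))).
  congr tsum; apply/funext => x.
  rewrite [in LHS]fE [in X in _ + X]gE; ring.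
rewrite tsum_ge0B; last 4 first.
- by move=> x; rewrite addr_ge0.
- by move=> x; rewrite addr_ge0.
- exact: summD sfp sgp.
- exact: summD sfn sgn.
rewrite !tsum_ge0D//=; try by move=> x /=.
rewrite /comp; ring.
Qed.

Lemma tsumN T (f : T -> R) : summ f -> tsum (fun x => - f x) = - tsum f.
Proof.
move=> sf; apply/eqP; rewrite -addr_eq0 -tsumD//; last exact: summN.
apply/eqP; rewrite (_ : (fun x => _) = fun=> 0); last by apply/funext => x;
  rewrite addNr.
by rewrite tsum_ge0E// esum1.
Qed.

Lemma tsumB T (f g : T -> R) : summ f -> summ g ->
  tsum (fun x => f x - g x) = tsum f - tsum g.
Proof. by move=> sf sg; rewrite tsumD ?tsumN//; exact: summN. Qed.

Lemma tsum_ge0 T (f : T -> R) : (forall x, 0 <= f x) -> 0 <= tsum f.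
Proof. by move=> f0; rewrite tsum_ge0E// fine_ge0// esum_ge0// => x _;
  rewrite lee_fin. Qed.

Lemma le_tsum T (f g : T -> R) : summ f -> summ g ->
  (forall x, f x <= g x) -> tsum f <= tsum g.
Proof. by move=> sf sg fg; rewrite -subr_ge0 -tsumB// tsum_ge0// => x;
  rewrite subr_ge0. Qed.

Lemma fset_le_tsum T (f : T -> R) (A : {fset T}) : (forall x, 0 <= f x) ->
  summ f -> \sum_(x <- A) f x <= tsum f.
Proof. by move=> f0 sf; rewrite -lee_fin EFin_tsum// fset_le_esum. Qed.

(** Bounds on finite sums survive coordinatewise limits; membership in l^2 and the bound on the norm
    are obtained together from them. *)
Lemma tsum_ub T (f : T -> R) (K : R) : (forall x, 0 <= f x) ->
  (forall A : {fset T}, \sum_(x <- A) f x <= K) -> summ f /\ tsum f <= K.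
Proof.
move=> f0 h; have sf : summ f.
  by apply: (@summ_ub _ _ K) => A; under eq_bigr do rewrite ger0_norm//.
by split => //; rewrite -lee_fin EFin_tsum// esum_le_fset.
Qed.

Lemma tsum_approx T (f : T -> R) (e : R) : (forall x, 0 <= f x) -> summ f ->
  0 < e -> exists A : {fset T}, tsum f - e < \sum_(x <- A) f x.
Proof.
move=> f0 sf e0; apply: contrapT => /forallNP h.
have [_] : summ f /\ tsum f <= tsum f - e.
  by apply: tsum_ub => // A; rewrite leNgt; exact/negP/h.
by move=> ?; lra.
Qed.

Lemma summ0 T : summ (fun _ : T => 0 : R).
Proof. by apply: (@summ_ub _ _ 0) => A; rewrite big1 // => *; rewrite normr0. Qed.

Lemma summZ T (c : R) (f : T -> R) : summ f -> summ (fun x => c * f x).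
Proof.
move=> sf; apply: (@summ_ub _ _ (`|c| * tsum (fun x => `|f x|))) => A.
under eq_bigr do rewrite normrM.
by rewrite -mulr_sumr ler_wpM2l// fset_le_tsum//; exact: summ_norm.
Qed.

Lemma le_tsumZ T (c : R) (f : T -> R) : 0 <= c -> (forall x, 0 <= f x) -> summ f ->
  tsum (fun x => c * f x) <= c * tsum f.
Proof.
move=> c0 f0 sf; have [] // := @tsum_ub _ (fun x => c * f x) (c * tsum f).
- by move=> x; rewrite mulr_ge0.
- by move=> A; rewrite -mulr_sumr ler_wpM2l// fset_le_tsum.
Qed.

Lemma tsum_ge0Z T (c : R) (f : T -> R) : 0 <= c -> (forall x, 0 <= f x) -> summ f ->
  tsum (fun x => c * f x) = c * tsum f.
Proof.
rewrite le_eqVlt => /predU1P[<- f0 sf|c0 f0 sf].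
  rewrite mul0r (_ : (fun x => _) = fun=> 0); last by apply/funext => x;
    rewrite mul0r.
  by rewrite tsum_ge0E// esum1.
apply/eqP; rewrite eq_le le_tsumZ ?(ltW c0)//=.
(* The reverse inequality is the same lemma for the factor [c^-1] and the family [c * f x]. *)
have := @le_tsumZ T c^-1 (fun x => c * f x); rewrite invr_ge0 (ltW c0).
have -> : (fun x => c^-1 * (c * f x)) = f.
  by apply/funext => x; rewrite mulrA mulVf ?mul1r ?gt_eqF.
move=> /(_ isT) h; rewrite mulrC -ler_pdivlMr// mulrC; apply: h.
- by move=> x; rewrite mulr_ge0// ltW.
- exact: summZ.
Qed.

Lemma tsumZ T (c : R) (f : T -> R) : summ f -> tsum (fun x => c * f x) = c * tsum f.
Proof.
move=> sf; wlog c0 : c / 0 <= c.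
  move=> H; have [/H//|/ltW c0] := leP 0 c.
  have := H (- c); rewrite oppr_ge0 => /(_ c0) h.
  rewrite -[LHS]opprK -tsumN; last exact: summZ.
  by rewrite (_ : (fun x => _) = (fun x => - c * f x)) ?h ?mulNr ?opprK//;
    apply/funext => x; rewrite mulNr.
have [sfp sfn fE ->] := tsum_pn sf.
have p0 a : 0 <= pos a by rewrite /pos le_max lexx orbT.
have n0 a : 0 <= neg a by rewrite /neg le_max lexx orbT.
transitivity (tsum (fun x => c * pos (f x) - c * neg (f x))).
  by congr tsum; apply/funext => x; rewrite {1}fE; ring.
rewrite tsumB; [|exact: summZ sfp|exact: summZ sfn].
by rewrite !tsum_ge0Z ?mulrBr//; move=> x /=.
Qed.

Lemma summ_reindex T T' (e : T -> T') (f : T' -> R) : injective e ->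
  summ f -> summ (f \o e).
Proof.
move=> ei sf; apply: (@summ_ub _ _ (tsum (fun x => `|f x|))) => A.
rewrite (_ : \sum_(x <- A) _ = \sum_(y <- (e @` A)%fset) `|f y|).
  by apply: fset_le_tsum => //; exact: summ_norm.
by rewrite big_imfset//= => x y _ _; exact: ei.
Qed.

Lemma tsum_reindex T T' (e : T -> T') (f : T' -> R) : bijective e ->
  tsum (f \o e) = tsum f.
Proof.
move=> be; have eb : set_bij setT setT e.
  case: be => g eK gK; split => //.
    by move=> x y _ _ /(can_inj eK).
  by move=> y _; exists (g y).
rewrite /tsum (reindex_esum _ _ e (EFin \o f)^\+%E eb)
  (reindex_esum _ _ e (EFin \o f)^\-%E eb).
by congr (fine (_ - _))%E; apply: eq_esum => x _; rewrite ?funeposE ?funenegE.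
Qed.

Lemma normr_tsum T (f : T -> R) : summ f -> `|tsum f| <= tsum (fun x => `|f x|).
Proof.
move=> sf; rewrite ler_norml -tsumN; last exact: summ_norm.
apply/andP; split; apply: le_tsum => //; try exact: summN (summ_norm sf);
  try exact: summ_norm.
- by move=> x; rewrite lerNl ler_normr lexx orbT.
- by move=> x; exact: ler_norm.
Qed.

Lemma tsum_sum T (I : Type) (s : seq I) (F : I -> T -> R) : (forall i, summ (F i)) ->
  summ (fun x => \sum_(i <- s) F i x) /\
  tsum (fun x => \sum_(i <- s) F i x) = \sum_(i <- s) tsum (F i).
Proof.
move=> sF; elim: s => [|i s [IH1 IH2]].
  rewrite big_nil; under eq_fun do rewrite big_nil; split; first exact: summ0.
  by rewrite tsum_ge0E// esum1.
rewrite big_cons; under eq_fun do rewrite big_cons.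
by split; [exact: summD|rewrite tsumD// IH2].
Qed.

End UnorderedSums.

(** * The Hilbert space of square-summable families *)

Section SquareSummable.
Context {R : realType} {T : choiceType}.
Implicit Types f g : T -> R.

Definition sqsumm f := summ (fun n => f n ^+ 2).

Definition sqsumm_pred : {pred T -> R} := fun f => `[< sqsumm f >].

Lemma sqsummM f g : sqsumm f -> sqsumm g -> summ (fun n => f n * g n).
Proof.
move=> sf sg; apply: summ_le (summD sf sg) => n.
rewrite ler_norml; apply/andP; split; rewrite -subr_ge0.
- have := sqr_ge0 (f n + g n); have := sqr_ge0 (f n); have := sqr_ge0 (g n); nra.
- have := sqr_ge0 (f n - g n); have := sqr_ge0 (f n); have := sqr_ge0 (g n); nra.
Qed.

Lemma sqsumm_submod : submod_closed sqsumm_pred.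
Proof.
split; first by apply/asboolP; rewrite /sqsumm; under eq_fun do rewrite expr0n;
  exact: summ0.
move=> a f g /asboolP sf /asboolP sg; apply/asboolP.
rewrite /sqsumm (_ : (fun n => _) = fun n => a ^+ 2 * f n ^+ 2 + 2 * a * (f n * g
  n) + g n ^+ 2).
  by apply: summD => //; apply: summD; apply: summZ => //; exact: sqsummM.
by apply/funext => n; rewrite (_ : (a *: f + g) n = a * f n + g n)//; ring.
Qed.

HB.instance Definition _ := GRing.isSubmodClosed.Build R (T -> R) sqsumm_pred
  sqsumm_submod.

End SquareSummable.

(** Bundling turns l^2 into a normed space, so that [is_derive] and continuity of curves refer to
    the l^2 norm and not to single coordinates. *)
Record l2 (R : realType) (T : choiceType) := L2 {
  l2fun :> T -> R ;
  l2_sqsumm : l2fun \in @sqsumm_pred R T }.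

Section L2Structure.
Context {R : realType} {T : choiceType}.

HB.instance Definition _ := [isSub for @l2fun R T].
HB.instance Definition _ := [Choice of l2 R T by <:].
HB.instance Definition _ := [SubChoice_isSubLmodule of l2 R T by <:].

Implicit Types x y z : l2 R T.

Lemma l2P x : sqsumm x.
Proof. by case: x => f /= /asboolP. Qed.

Lemma l2_ext x y : (forall n, x n = y n) -> x = y.
Proof. by move=> xy; apply/val_inj/funext. Qed.

Lemma l2D x y n : (x + y) n = x n + y n. Proof. by []. Qed.
Lemma l2N x n : (- x) n = - x n. Proof. by []. Qed.
Lemma l2B x y n : (x - y) n = x n - y n. Proof. by []. Qed.
Lemma l2Z a x n : (a *: x) n = a * x n. Proof. by []. Qed.
Lemma l20 n : (0 : l2 R T) n = 0. Proof. by []. Qed.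
Definition l2E := (l2D, l2N, l2Z, l20).

Definition dot x y : R := tsum (fun n => x n * y n).

Lemma summ_dot x y : summ (fun n => x n * y n).
Proof. by apply: sqsummM; exact: l2P. Qed.

Lemma dotC x y : dot x y = dot y x.
Proof. by congr tsum; apply/funext => n; rewrite mulrC. Qed.

Lemma dotDl x y z : dot (x + y) z = dot x z + dot y z.
Proof.
rewrite -tsumD; [|exact: summ_dot|exact: summ_dot].
by congr tsum; apply/funext => n; rewrite l2E mulrDl.
Qed.

Lemma dotZl a x y : dot (a *: x) y = a * dot x y.
Proof.
rewrite -tsumZ; last exact: summ_dot.
by congr tsum; apply/funext => n; rewrite l2E mulrA.
Qed.

Lemma dotDr x y z : dot z (x + y) = dot z x + dot z y.
Proof. by rewrite dotC dotDl !(dotC z). Qed.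
Lemma dotZr a x y : dot y (a *: x) = a * dot y x.
Proof. by rewrite dotC dotZl (dotC y). Qed.
Lemma dotNl x y : dot (- x) y = - dot x y.
Proof. by rewrite -scaleN1r dotZl mulN1r. Qed.
Lemma dotNr x y : dot y (- x) = - dot y x.
Proof. by rewrite dotC dotNl (dotC y). Qed.
Lemma dotBl x y z : dot (x - y) z = dot x z - dot y z.
Proof. by rewrite dotDl dotNl. Qed.
Lemma dotBr x y z : dot z (x - y) = dot z x - dot z y.
Proof. by rewrite dotDr dotNr. Qed.
Lemma dot0l x : dot 0 x = 0.
Proof. by rewrite -(scale0r 0) dotZl mul0r. Qed.
Lemma dot0r x : dot x 0 = 0. Proof. by rewrite dotC dot0l. Qed.

Lemma dot_suml (I : Type) (r : seq I) (F : I -> l2 R T) y :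
  dot (\sum_(i <- r) F i) y = \sum_(i <- r) dot (F i) y.
Proof.
by elim: r => [|i r IH]; rewrite ?big_nil ?dot0l// !big_cons dotDl IH.
Qed.

Lemma dotxxE x : dot x x = tsum (fun n => x n ^+ 2).
Proof. by congr tsum; apply/funext => n; rewrite expr2. Qed.

Lemma dotxx_ge0 x : 0 <= dot x x.
Proof. by rewrite dotxxE tsum_ge0// => n; rewrite sqr_ge0. Qed.

Lemma sqr_coord_le x n : x n ^+ 2 <= dot x x.
Proof.
rewrite dotxxE; have := @fset_le_tsum _ _ (fun n => x n ^+ 2) [fset n]%fset.
by rewrite big_seq_fset1; apply; [move=> m; rewrite sqr_ge0|exact: l2P].
Qed.

Lemma dotxx_eq0 x : dot x x = 0 -> x = 0.
Proof.
move=> x0; apply: l2_ext => n; apply/eqP; rewrite -sqrf_eq0 eq_le sqr_ge0 andbT.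
by rewrite -x0 sqr_coord_le.
Qed.

Let nrm x := Num.sqrt (dot x x).

Let nrm_sqr x : nrm x ^+ 2 = dot x x.
Proof. by rewrite sqr_sqrtr ?dotxx_ge0. Qed.

Let CS x y : dot x y <= nrm x * nrm y.
Proof.
have [y0|y0] := eqVneq (dot y y) 0.
  by rewrite (dotxx_eq0 y0) dot0r mulr_ge0 ?sqrtr_ge0.
rewrite -sqrtrM ?dotxx_ge0//; apply: le_trans (ler_norm _) _.
rewrite -sqrtr_sqr; apply: ler_wsqrtr.
have yp : 0 < dot y y by rewrite lt_neqAle eq_sym y0 dotxx_ge0.
(* The squared norm of the component of x orthogonal to y is nonnegative. *)
have := dotxx_ge0 (x - (dot x y / dot y y) *: y).
rewrite dotBl !dotBr !dotZl !dotZr (dotC y x).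
rewrite (_ : _ - _ = dot x x - dot x y ^+ 2 / dot y y); last by field.
by rewrite subr_ge0 ler_pdivrMr.
Qed.

Let nrmD x y : nrm (x + y) <= nrm x + nrm y.
Proof.
rewrite -(@ler_pXn2r _ 2)// ?nnegrE ?addr_ge0 ?sqrtr_ge0//.
rewrite nrm_sqr sqrrD !nrm_sqr dotDl !dotDr (dotC y x).
have := CS x y; lra.
Qed.

Let nrmZ a x : nrm (a *: x) = `|a| * nrm x.
Proof. by rewrite /nrm dotZl dotZr mulrA -expr2 sqrtrM ?sqr_ge0// sqrtr_sqr. Qed.

Let nrm_eq0 x : nrm x = 0 -> x = 0.
Proof. by move=> h; apply: dotxx_eq0; rewrite -nrm_sqr h expr0n. Qed.

HB.instance Definition _ := Lmodule_isNormed.Build R (l2 R T) nrmD nrmZ nrm_eq0.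

Lemma dotxx x : dot x x = `|x| ^+ 2.
Proof. by rewrite -nrm_sqr. Qed.

Lemma dot_le x y : dot x y <= `|x| * `|y|.
Proof. exact: CS. Qed.

Lemma normr_dot x y : `|dot x y| <= `|x| * `|y|.
Proof.
rewrite ler_norml dot_le andbT lerNl -dotNl; apply: le_trans (dot_le _ _) _.
by rewrite normrN.
Qed.

Lemma coord_le x n : `|x n| <= `|x|.
Proof.
by rewrite -(@ler_pXn2r _ 2)// ?nnegrE// -dotxx -normrX ger0_norm ?sqr_ge0//
  sqr_coord_le.
Qed.

Lemma normrE_sqr x : `|x| ^+ 2 = tsum (fun n => x n ^+ 2).
Proof. by rewrite -dotxx dotxxE. Qed.

Lemma fset_le_norm x (A : {fset T}) : \sum_(n <- A) x n ^+ 2 <= `|x| ^+ 2.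
Proof. by rewrite normrE_sqr fset_le_tsum//; [move=> n;
  rewrite sqr_ge0|exact: l2P]. Qed.

Lemma norm_ub x (K : R) : 0 <= K ->
  (forall A : {fset T}, \sum_(n <- A) x n ^+ 2 <= K ^+ 2) -> `|x| <= K.
Proof.
move=> K0 h; rewrite -(@ler_pXn2r _ 2)// ?nnegrE// normrE_sqr.
by have [] // := @tsum_ub _ _ (fun n => x n ^+ 2) (K ^+ 2) => n; rewrite sqr_ge0.
Qed.

(* Sequences outside of l^2 are sent to 0. *)
Definition mkl2 (f : T -> R) : l2 R T := insubd 0 f.

Lemma mkl2E f : sqsumm f -> mkl2 f = f :> (T -> R).
Proof.
by move=> sf; rewrite /mkl2; apply: (@insubdK _ sqsumm_pred); apply/asboolP.
Qed.

Lemma mkl2_val x : mkl2 x = x.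
Proof. by apply: val_inj; apply: mkl2E; exact: l2P. Qed.

Lemma mkl2_ub f (K : R) : 0 <= K ->
  (forall A : {fset T}, \sum_(n <- A) f n ^+ 2 <= K ^+ 2) ->
  (mkl2 f = f :> (T -> R)) /\ `|mkl2 f| <= K.
Proof.
move=> K0 h; have sf : sqsumm f.
  by have [] // := @tsum_ub _ _ (fun n => f n ^+ 2) (K ^+ 2) => n; rewrite sqr_ge0.
by split; [exact: mkl2E|apply: norm_ub; rewrite ?mkl2E].
Qed.

End L2Structure.

(** * Curves in l^2 *)

Lemma scaleRE (R : realType) (a b : R) : a *: b = a * b.
Proof. by []. Qed.

Section Derivatives.
Context {R : realType}.
Implicit Types (W : normedModType R).

(** A first-order expansion with an error bound is easier to add, multiply and compose than a
    difference quotient, and the point s = t needs no exception. *)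
Lemma is_derive_epsP W (u : R -> W) (t : R) (w : W) :
  is_derive t 1 u w <->
  forall e : R, 0 < e -> \forall s \near t, `|u s - u t - (s - t) *: w| <= e * `|s
    - t|.
Proof.
have E (h : R) : h != 0 -> `|w - h^-1 *: (u (h *: 1 + t) - u t)| =
    `|h|^-1 * `|u (h + t) - u t - (h + t - t) *: w|.
  move=> h0; rewrite addrK -normfV -normrZ -normrN opprB [h *: 1]mulr1 !scalerBr.
  by rewrite scalerA mulVf// scale1r.
split.
- move=> [du Du] e e0.
  have : (fun h => h^-1 *: ((u \o shift t) (h *: 1) - u t)) @ 0^' --> w.
    by rewrite -Du; exact: du.
  move=> /cvgrPdist_le /(_ _ e0) [d /= d0 H].
  exists d => //= s /= std.
  have [->|st] := eqVneq s t; first by rewrite !subrr scale0r subr0 !normr0 mulr0.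
  have st0 : s - t != 0 by rewrite subr_eq0.
  rewrite distrC in std.
  have := H (s - t); rewrite /= sub0r normrN => /(_ std st0).
  by rewrite E// subrK mulrC ler_pdivrMr// normr_gt0.
- move=> H.
  have c : (fun h => h^-1 *: ((u \o shift t) (h *: 1) - u t)) @ 0^' --> w.
    apply/cvgrPdist_le => e e0; have [d /= d0 K] := H e e0.
    exists d => //= h /=; rewrite sub0r normrN => hd h0.
    rewrite E// mulrC ler_pdivrMr ?normr_gt0//.
    by have := K (h + t); rewrite /= distrC addrK => /(_ hd).
  by split; [apply/cvg_ex; exists w|apply/cvg_lim].
Qed.

Lemma is_derive_cont W (u : R -> W) (t : R) (w : W) :
  is_derive t 1 u w -> {for t, continuous u}.
Proof. by move=> [du _]; apply/differentiable_continuous/derivable1_diffP. Qed.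

Lemma is_derive_lip W (u : R -> W) (t : R) (w : W) : is_derive t 1 u w ->
  \forall s \near t, `|u s - u t| <= (`|w| + 1) * `|s - t|.
Proof.
move=> /is_derive_epsP /(_ 1 ltr01); apply: filterS => s h.
rewrite -[u s - u t](subrK ((s - t) *: w)) (le_trans (ler_normD _ _))//.
by rewrite normrZ mulrDl addrC mulrC lerD2l.
Qed.

Lemma is_derive_lin W W' (L : W -> W') (K : R) (u : R -> W) (t : R) (w : W) :
  (forall x y, L (x - y) = L x - L y) -> (forall a x, L (a *: x) = a *: L x) ->
  (forall x, `|L x| <= K * `|x|) ->
  is_derive t 1 u w -> is_derive t 1 (fun s => L (u s)) (L w).
Proof.
move=> LB LZ LK /is_derive_epsP du; apply/is_derive_epsP => e e0.
(* No sign of [K] is assumed, whence this positive divisor. *)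
have K1 : 0 < `|K| + 1 by rewrite ltr_pwDr.
have /du : 0 < e / (`|K| + 1) by rewrite divr_gt0.
apply: filterS => s h; rewrite -!LB -LZ -LB.
apply: le_trans (LK _) _; apply: (@le_trans _ _ ((`|K| + 1) * `|u s - u t - (s - t)
  *: w|)).
  by rewrite ler_wpM2r// (le_trans (ler_norm _))// lerDl.
apply: le_trans (ler_wpM2l (ltW K1) h) _.
by rewrite mulrA mulrCA divff ?gt_eqF// mulr1.
Qed.

Lemma is_derive_add W (u v : R -> W) (t : R) (a b : W) :
  is_derive t 1 u a -> is_derive t 1 v b -> is_derive t 1 (fun s => u s + v s) (a +
    b).
Proof. by move=> du dv; exact: is_deriveD. Qed.

Lemma is_derive_opp W (u : R -> W) (t : R) (a : W) :
  is_derive t 1 u a -> is_derive t 1 (fun s => - u s) (- a).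
Proof. by move=> du; exact: is_deriveN. Qed.

Lemma is_derive_sub W (u v : R -> W) (t : R) (a b : W) :
  is_derive t 1 u a -> is_derive t 1 v b -> is_derive t 1 (fun s => u s - v s) (a -
    b).
Proof. by move=> du dv; exact: is_deriveB. Qed.

Lemma is_derive_scale W (u : R -> W) (t c : R) (a : W) :
  is_derive t 1 u a -> is_derive t 1 (fun s => c *: u s) (c *: a).
Proof. by move=> du; exact: is_deriveZ. Qed.

Lemma is_derive_mull (u : R -> R) (t c a : R) :
  is_derive t 1 u a -> is_derive t 1 (fun s => c * u s) (c * a).
Proof. exact: (@is_derive_scale R). Qed.

Lemma is_derive_bigsum (I : Type) (r : seq I) W (u : I -> R -> W) (t : R) (a : I ->
  W) :
  (forall i, is_derive t 1 (u i) (a i)) ->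
  is_derive t 1 (fun s => \sum_(i <- r) u i s) (\sum_(i <- r) a i).
Proof.
move=> du; elim: r => [|i r IH].
  by rewrite big_nil; under eq_fun do rewrite big_nil; exact: is_derive_cst.
rewrite big_cons; under eq_fun do rewrite big_cons.
exact: is_derive_add.
Qed.

Lemma le0_derive_le (F F' : R -> R) (a b : R) : a <= b ->
  {within `[a, b], continuous F} ->
  (forall t, a < t < b -> is_derive t 1 F (F' t)) ->
  (forall t, a < t < b -> F' t <= 0) -> F b <= F a.
Proof.
rewrite le_eqVlt => /predU1P[-> //|ab] cF dF F'0.
have dF' t : t \in `]a, b[ -> is_derive t 1 F (F' t) by rewrite in_itv/=; exact: dF.
have [c] := MVT ab dF' cF.
rewrite in_itv /= => /F'0 c0 e; rewrite -subr_le0 e mulr_le0_ge0// subr_ge0;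
  exact: ltW.
Qed.

Lemma is_derive_restr W (u v : R -> W) (t : R) (w : W) :
  (\forall s \near t, u s = v s) -> is_derive t 1 u w -> is_derive t 1 v w.
Proof.
move=> uv /is_derive_epsP du; apply/is_derive_epsP => e e0.
have uvt := nbhs_singleton uv.
near=> s; rewrite -(near uv s)// -uvt; near: s; exact: du.
Unshelve. all: by end_near. Qed.

End Derivatives.

(** * Finite truncations of families *)

Section FiniteSupport.
Context {R : realType} {T : choiceType}.
Implicit Types (A : {fset T}) (f : T -> R).

Lemma fin_supp_tsum A f :
  summ (fun n => if n \in A then f n else 0) /\
  tsum (fun n => if n \in A then f n else 0) = \sum_(n <- A) f n.
Proof.
have s1 (m : T) : summ (fun n => if n == m then 1 else 0 : R) /\
    tsum (fun n => if n == m then 1 else 0 : R) = 1.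
  have p (n : T) : 0 <= if n == m then 1 else 0 : R by case: ifP.
  have [|s le] := @tsum_ub _ _ (fun n => if n == m then 1 else 0 : R) 1 p.
    move=> B; case: (boolP (m \in B)) => mB.
      rewrite (big_fsetD1 m)//= eqxx big1_fset ?addr0// => n.
      by rewrite in_fsetD1 => /andP[/negbTE ->].
    rewrite big1_fset// => n nB _; case: eqP => // nm.
    by move: mB; rewrite -nm nB.
  split => //; apply/eqP; rewrite eq_le le /=.
  have := @fset_le_tsum _ _ (fun n => if n == m then 1 else 0 : R) [fset m]%fset p s.
  by rewrite big_seq_fset1 eqxx.
(* The truncated family is a finite combination of unit masses, to which [tsum_sum] applies. *)
have -> : (fun n => if n \in A then f n else 0) =
    (fun n => \sum_(m <- A) f m * (if n == m then 1 else 0)).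
  apply/funext => n; case: ifPn => nA.
    rewrite (big_fsetD1 n)//= eqxx mulr1 big1_fset ?addr0// => m.
    by rewrite in_fsetD1 eq_sym => /andP[/negbTE ->]; rewrite mulr0.
  rewrite big1_fset// => m mA _; case: eqP => [nm|]; last by rewrite mulr0.
  by move: nA; rewrite nm mA.
have [|sE ->] := @tsum_sum _ _ _ A (fun m n => f m * (if n == m then 1 else 0)).
  by move=> m; apply: summZ; have [] := s1 m.
split => //; apply: eq_bigr => m _.
by have [sm em] := s1 m; rewrite tsumZ// em mulr1.
Qed.

Definition restr A f : l2 R T := mkl2 (fun n => if n \in A then f n else 0).

Lemma restrE A f n : restr A f n = if n \in A then f n else 0.
Proof.
rewrite /restr mkl2E// /sqsumm.
have [+ _] := @fin_supp_tsum A (fun n => f n ^+ 2).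
by congr summ; apply/funext => m; case: ifP; rewrite ?expr0n.
Qed.

Lemma dot_restr A f (x : l2 R T) : dot (restr A f) x = \sum_(n <- A) f n * x n.
Proof.
have [_ <-] := fin_supp_tsum A (fun n => f n * x n).
by congr tsum; apply/funext => n; rewrite restrE; case: ifP; rewrite ?mul0r.
Qed.

Lemma norm_restr A f : `|restr A f| ^+ 2 = \sum_(n <- A) f n ^+ 2.
Proof.
rewrite -dotxx dot_restr; apply: eq_fbigr => n nA _.
by rewrite restrE nA expr2.
Qed.

Lemma restr_approx (x : l2 R T) (e : R) : 0 < e ->
  exists A : {fset T}, `|x - restr A x| < e.
Proof.
move=> e0; have [|A] := tsum_approx _ (l2P x) (exprn_gt0 2 e0).
  by move=> n; rewrite sqr_ge0.
exists A; rewrite -(@ltr_pXn2r _ 2)// ?nnegrE// ?ltW//.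
(* Truncation is an orthogonal projection, so the squared error is |x|^2 minus the finite sum of
   squares over [A]. *)
rewrite -dotxx dotBl !dotBr (dotC x) dotxx (dotxx (restr A x)) norm_restr dot_restr.
rewrite normrE_sqr; under [X in _ - X - _]eq_bigr do rewrite -expr2.
by rewrite subrr subr0 ltrBlDr -ltrBlDl.
Qed.

End FiniteSupport.

Section CurvesInL2.
Context {R : realType} {T : choiceType}.
Local Notation V := (l2 R T).

Lemma is_derive_coord (u : R -> V) (t : R) w n :
  is_derive t 1 u w -> is_derive t 1 (fun s => u s n) (w n).
Proof.
apply: (@is_derive_lin _ _ _ (fun x : V => x n : R) 1) => //.
by move=> x; rewrite mul1r coord_le.
Qed.

Lemma is_derive_dot (u v : R -> V) (t : R) u' v' :
  is_derive t 1 u u' -> is_derive t 1 v v' ->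
  is_derive t 1 (fun s => dot (u s) (v s)) (dot u' (v t) + dot (u t) v').
Proof.
move=> du dv; have /is_derive_epsP eu := du; have /is_derive_epsP ev := dv.
have lv := is_derive_lip dv.
apply/is_derive_epsP => e e0.
(* [M - 1] adds the coefficients of the three errors of the expansion below, each counted in units
   of d |s - t|; the final 1 makes [M] positive. *)
pose M := `|v t| + `|u t| + `|u'| * (`|v'| + 1) + (`|v'| + 1) + 1.
have M0 : 0 < M by rewrite /M ltr_pwDr// !addr_ge0// mulr_ge0// addr_ge0.
pose d := Num.min (e / M) 1.
have d0 : 0 < d by rewrite lt_min divr_gt0//=.
near=> s.
rewrite (_ : _ - _ = dot (u s - u t - (s - t) *: u') (v s)
   + dot (u t) (v s - v t - (s - t) *: v') + (s - t) * dot u' (v s - v t));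
     last first.
  by rewrite !(dotBl, dotBr, dotZl, dotZr) scaleRE; ring.
have hu : `|u s - u t - (s - t) *: u'| <= d * `|s - t| by near: s; exact: eu.
have hv : `|v s - v t - (s - t) *: v'| <= d * `|s - t| by near: s; exact: ev.
have hl : `|v s - v t| <= (`|v'| + 1) * `|s - t| by near: s; exact: lv.
have st : `|s - t| <= d.
  near: s; exists d => //= s /=; rewrite distrC; exact: ltW.
have st1 : `|s - t| <= 1 by rewrite (le_trans st)// ge_min lexx orbT.
have hvs : `|v s| <= `|v t| + (`|v'| + 1).
  rewrite -[v s](subrK (v t)) addrC (le_trans (ler_normD _ _))// lerD2l.
  by rewrite (le_trans hl)// ler_piMr// addr_ge0.
have dM : d * M <= e by rewrite -ler_pdivlMr// ge_min lexx.
apply: le_trans (ler_normD _ _) _; apply: le_trans (lerD (ler_normD _ _) (lexx _)) _.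
apply: (@le_trans _ _ (d * M * `|s - t|)); last by rewrite ler_wpM2r.
have a1 : `|dot (u s - u t - (s - t) *: u') (v s)| <= (d * `|s - t|) * (`|v t| +
  (`|v'| + 1)).
  by apply: le_trans (normr_dot _ _) _; apply: ler_pM.
have a2 : `|dot (u t) (v s - v t - (s - t) *: v')| <= `|u t| * (d * `|s - t|).
  by apply: le_trans (normr_dot _ _) _; apply: ler_pM.
have a3 : `|(s - t) * dot u' (v s - v t)| <= `|s - t| * (`|u'| * ((`|v'| + 1) * d)).
  rewrite normrM ler_wpM2l// (le_trans (normr_dot _ _))// ler_wpM2l//.
  by apply: le_trans hl _; rewrite ler_wpM2l// addr_ge0.
apply: le_trans (lerD (lerD a1 a2) a3) _.
rewrite (_ : _ + _ = d * (M - 1) * `|s - t|); last by rewrite /M; ring.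
by rewrite ler_wpM2r// ler_wpM2l ?(ltW d0)// gerBl.
Unshelve. all: by end_near. Qed.

(* Test the increment against its own finite truncation and apply the scalar
   mean value theorem. *)
Lemma coord_mean_value (u : R -> T -> R) (v : R -> V) (k k' : R -> R) (a b : R) :
  a <= b -> (forall n, {within `[a, b], continuous (fun s => u s n)}) ->
  {within `[a, b], continuous k} ->
  (forall t n, a < t < b -> is_derive t 1 (fun s => u s n) (v t n)) ->
  (forall t, a < t < b -> is_derive t 1 k (k' t)) ->
  (forall t, a < t < b -> `|v t| <= k' t) ->
  0 <= k b - k a /\
  forall A : {fset T}, \sum_(n <- A) (u b n - u a n) ^+ 2 <= (k b - k a) ^+ 2.
Proof.
move=> ab cu ck du dk vk.
have kba : 0 <= k b - k a.
  rewrite subr_ge0 -lerN2.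
  apply: (@le0_derive_le _ (fun s => - k s) (fun s => - k' s)) => //.
  - by move=> x; apply: continuousN; exact: ck.
  - by move=> t /dk h; exact: is_deriveN.
  - by move=> t /vk h; rewrite oppr_le0 (le_trans _ h).
split => // A.
pose z n := u b n - u a n; pose Z := restr A z.
have S2 : `|Z| ^+ 2 = \sum_(n <- A) (u b n - u a n) ^+ 2 by rewrite norm_restr.
pose h s := \sum_(n <- A) z n * u s n - `|Z| * k s.
pose h' s := dot Z (v s) - `|Z| * k' s.
have : h b <= h a.
  apply: (@le0_derive_le _ h h' a b ab).
  - have cs (c : R) (g : R -> R) : {within `[a, b], continuous g} -> {within `[a,
    b], continuous (fun s => c * g s)}.
      by move=> cg x; apply: (@cvgM _ _ _ _ _ _ c); [exact: cvg_cst|exact: cg].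
    have cS : {within `[a, b], continuous (fun s => \sum_(n <- A) z n * u s n)}.
      move=> x; apply: cvg_big => [|n _]; first exact: add_continuous.
      exact: cs.
    by move=> x; apply: cvgB; [exact: cS|exact: cs].
  - move=> t tab; rewrite /h /h' dot_restr.
    apply: is_derive_sub; last by apply: is_derive_mull; exact: dk.
    by apply: is_derive_bigsum => n; apply: is_derive_mull; exact: du.
  - move=> t tab; rewrite subr_le0 (le_trans (dot_le _ _))// ler_wpM2l//; exact: vk.
move=> hba.
have zu : \sum_(n <- A) z n * u b n - \sum_(n <- A) z n * u a n = `|Z| ^+ 2.
  by rewrite S2 -sumrB; apply: eq_bigr => n _; rewrite -mulrBr expr2.
have : `|Z| * `|Z| <= `|Z| * (k b - k a).
  by rewrite -expr2 -zu mulrBr; move: hba; rewrite /h; lra.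
rewrite -S2; have [->|Z0] := eqVneq `|Z| 0; first by rewrite expr0n/= sqr_ge0.
rewrite ler_pM2l; last by rewrite lt_neqAle eq_sym Z0 normr_ge0.
by move=> le; rewrite ler_pXn2r// nnegrE.
Qed.

End CurvesInL2.

Lemma lip_continuous (R : realType) (W W' : normedModType R) (f : W -> W') (K : R) :
  (forall x y, `|f x - f y| <= K * `|x - y|) -> continuous f.
Proof.
move=> fK x; apply/cvgrPdist_lt => e e0.
have K1 : 0 < `|K| + 1 by rewrite ltr_pwDr.
have : \forall y \near x, `|x - y| < e / (`|K| + 1).
  have /cvgrPdist_lt := @cvg_id _ (nbhs x); apply.
  by rewrite divr_gt0.
apply: filterS => y; rewrite ltr_pdivlMr// mulrC; apply: le_lt_trans.
apply: le_trans (fK _ _) _; rewrite ler_wpM2r// (le_trans (ler_norm _))//.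
by rewrite lerDl.
Qed.

Lemma is_derive_const (R : realType) (W : normedModType R) (a : W) (t : R) :
  is_derive t 1 (fun=> a) 0.
Proof. exact: is_derive_cst. Qed.

(** * Primitives and completeness in l^2 *)

Section Primitives.
Context {R : realType} {T : choiceType}.
Local Notation V := (l2 R T).

Lemma coord_continuous n : continuous (fun x : V => x n : R).
Proof.
by apply: (@lip_continuous _ _ _ _ 1) => x y; rewrite mul1r;
  exact: (coord_le (x - y) n).
Qed.

(** The velocity is compared with the derivative of a scalar function and not with a constant,
    because the Picard estimates integrate an exponential weight. *)
Lemma norm_increment_le (u v : R -> V) (k k' : R -> R) (a b : R) :
  a <= b -> {within `[a, b], continuous u} -> {within `[a, b], continuous k} ->
  (forall t, a < t < b -> is_derive t 1 u (v t)) ->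
  (forall t, a < t < b -> is_derive t 1 k (k' t)) ->
  (forall t, a < t < b -> `|v t| <= k' t) ->
  `|u b - u a| <= k b - k a.
Proof.
move=> ab cu ck du dk vk.
have cu' n : {within `[a, b], continuous (fun s => u s n : R)}.
  move=> x; apply: (@cvg_comp _ _ _ u (fun x : V => x n : R)); first exact: cu.
  exact: coord_continuous.
have du' t n : a < t < b -> is_derive t 1 (fun s => u s n) (v t n).
  by move=> tab; apply: is_derive_coord; exact: du.
have [kk H] := coord_mean_value ab cu' ck du' dk vk.
exact: norm_ub.
Qed.

(** Here [u] is a mere family of coordinates, not known to be l^2-valued: the bound on finite sums
    is what allows [primitive_l2] to prove that it is. The times [a] and [b] are unordered, so that
    increments on both sides of a time are covered. *)
Lemma coord_increment_const (u : R -> T -> R) (v : R -> V) (K a b : R) :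
  (forall t n, Num.min a b <= t <= Num.max a b -> is_derive t 1 (fun s => u s n) (v
    t n)) ->
  (forall t, Num.min a b <= t <= Num.max a b -> `|v t| <= K) ->
  forall A : {fset T}, \sum_(n <- A) (u b n - u a n) ^+ 2 <= (K * `|b - a|) ^+ 2.
Proof.
wlog ab : a b / a <= b.
  move=> H; case/orP: (le_total a b) => [ab|ba] du vK A; first exact: H ab du vK A.
  rewrite distrC; under eq_bigr do rewrite -sqrrN opprB.
  by apply: (H b a) => // *; [apply: du|apply: vK]; rewrite minC maxC.
rewrite (min_l ab) (max_r ab) => du vK A.
have [||||| _ H] := @coord_mean_value _ _ u v (fun s => K * s) (fun=> K) a b ab.
- move=> n; apply: derivable_within_continuous => t; rewrite in_itv /= => tab.
  by have [] := du t n tab.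
- by apply: continuous_subspaceT => x; apply: mulrl_continuous.
- by move=> t n /andP[/ltW at_ /ltW tb]; apply: du; rewrite at_.
- move=> t _; rewrite -[X in is_derive _ _ _ X]mulr1; apply: is_derive_mull;
  exact: is_derive_id.
- by move=> t /andP[/ltW at_ /ltW tb]; apply: vK; rewrite at_.
by rewrite ger0_norm ?subr_ge0// mulrBr.
Qed.

(** Derivatives of the coordinates alone give no derivative in norm, as their rates of convergence
    may depend on the coordinate. Continuity of [v] in l^2 supplies the uniformity: the curve
    [u s - s * v t] has small velocity near t, hence a small increment in norm. *)
Lemma is_derive_l2 (u v : R -> V) (t : R) :
  (\forall s \near t, forall n, is_derive s (1 : R) (fun s => u s n : R) (v s n)) ->
  {for t, continuous v} -> is_derive t 1 u (v t).
Proof.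
move=> [r /= r0 du] cv; apply/is_derive_epsP => e e0.
have := cv => /cvgrPdist_le /(_ _ e0) [d /= d0 Hd].
exists (Num.min d r); first by rewrite /= lt_min d0.
move=> s /=; rewrite lt_min => /andP[sd sr].
have between (x : R) : Num.min t s <= x <= Num.max t s -> `|t - x| <= `|t - s|.
  case: (leP t s) => ts /andP[mx xm]; rewrite ler_norml.
    by rewrite (ler0_norm (_ : t - s <= 0)) ?subr_le0//; apply/andP; split; lra.
  by rewrite (ger0_norm (_ : 0 <= t - s)) ?subr_ge0 ?(ltW ts)//; apply/andP; split;
    lra.
apply: norm_ub; first by rewrite mulr_ge0// ltW.
move=> A.
rewrite (eq_bigr (fun n => ((u s n - s * v t n) - (u t n - t * v t n)) ^+ 2));
  last first.
  by move=> n _; rewrite !l2E; congr (_ ^+ 2); ring.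
apply: (@coord_increment_const (fun s n => u s n - s * v t n) (fun s => v s - v t)).
- move=> x n /between xs; rewrite l2B.
  apply: is_derive_sub; first by apply: du; exact: le_lt_trans xs sr.
  under eq_fun do rewrite mulrC; rewrite -[X in is_derive _ _ _ X]mulr1.
  by apply: is_derive_mull; exact: is_derive_id.
- by move=> x /between xs; rewrite distrC; apply: Hd; exact: le_lt_trans xs sd.
Qed.

(* Integrating from -1 makes t = 0 an interior point, so that derivatives at
   the initial time are two-sided. *)
Lemma primitive_real (f : R -> R) : continuous f ->
  exists2 F : R -> R, F 0 = 0 & forall t : R, -1 < t -> is_derive t 1 F (f t).
Proof.
move=> cf.
pose G x := (\int[lebesgue_measure]_(t in `[(-1 : R), x]) f t)%R.
exists (fun x => G x - G 0); first by rewrite subrr.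
move=> t t1.
have tt : t < t + 1 by rewrite ltrDl.
have [|dG GE] := @continuous_FTC1_closed _ f (-1) t (t + 1) tt _ t1 (cf t).
  apply: continuous_compact_integrable; first exact: segment_compact.
  exact: continuous_subspaceT.
have dG' : is_derive t 1 G (f t) by split; [exact: dG|rewrite -derive1E; exact: GE].
by have := is_derive_sub dG' (is_derive_const (G 0) t); rewrite subr0.
Qed.

Lemma primitive_l2 (v : R -> V) (x0 : V) : continuous v ->
  exists2 u : R -> V, u 0 = x0 & forall t : R, -1 < t -> is_derive t 1 u (v t).
Proof.
move=> cv.
have cvn n : continuous (fun s => v s n : R).
  by move=> t; apply: (@cvg_comp _ _ _ v (fun x : V => x n : R));
      [exact: cv|exact: coord_continuous].
have /choice[F FP] n : exists F : R -> R, F 0 = 0 /\ forall t : R, -1 < t ->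
  is_derive t 1 F (v t n).
  by have [F ? ?] := primitive_real (cvn n); exists F.
have dF n (t : R) : -1 < t -> is_derive t 1 (F n) (v t n) by have [_] := FP n; apply.
have F0 n : F n 0 = 0 by have [] := FP n.
have FE (t : R) : -1 < t -> mkl2 (fun n => F n t) = (fun n => F n t) :> (T -> R).
  move=> t1.
  (* The velocity is bounded on the compact segment between 0 and t, so the finite sums of squares
     of the scalar primitives are bounded too. *)
  have bd : exists K, forall s : R, Num.min 0 t <= s <= Num.max 0 t -> `|v s| <= K.
    have m : Num.min 0 t <= Num.max 0 t by rewrite ge_min le_max lexx.
    have [|c _ H] := @EVT_max _ (fun s => `|v s|) _ _ m.
      by apply: continuous_subspaceT => x; apply: cvg_norm; exact: cv.
    by exists `|v c| => s sI; apply: H; rewrite in_itv.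
  have [K HK] := bd.
  have K0 : 0 <= K.
    by apply: le_trans (HK t _) => //; rewrite ge_min le_max !lexx !orbT.
  have [||//] := @mkl2_ub _ _ (fun n => F n t) (K * `|t - 0|).
    by rewrite mulr_ge0.
  move=> A; rewrite (eq_bigr (fun n => (F n t - F n 0) ^+ 2)) => [|n _];
    last by rewrite F0 subr0.
  apply: (@coord_increment_const (fun s n => F n s) v K 0 t) => // s n /andP[ms _].
  apply: dF; apply: lt_le_trans ms; rewrite lt_min t1; lra.
exists (fun t => x0 + mkl2 (fun n => F n t)).
  rewrite -[RHS]addr0; congr (_ + _); apply: l2_ext => n.
  by rewrite FE ?F0//; lra.
move=> t t1.
suff du : is_derive t 1 (fun s => mkl2 (fun n => F n s)) (v t).
  by have := is_derive_add (is_derive_const x0 t) du; rewrite add0r.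
apply: is_derive_l2; last exact: cv.
exists (t + 1) => /=; first lra.
move=> s /=; rewrite ltr_norml => /andP[_ s1] n.
have s1' : -1 < s by lra.
apply: is_derive_restr (dF n s s1').
exists (s + 1) => /=; first lra.
move=> x /=; rewrite ltr_norml => /andP[_ x1].
by rewrite FE//; lra.
Qed.

(** Completeness of l^2 in the form needed for the iteration, with a rate: the coordinates converge,
    and the bounds pass to the limit on finite sets. *)
Lemma geometric_cvg (x : nat -> V) (a : R) :
  (forall k, `|x k.+1 - x k| <= a / 2 ^+ k) ->
  exists y, forall k, `|y - x k| <= 2 * a / 2 ^+ k.
Proof.
move=> H.
have a0 : 0 <= a by have := le_trans (normr_ge0 _) (H 0%N); rewrite expr0 divr1.
have bd k j : `|x (k + j)%N - x k| <= 2 * a / 2 ^+ k * (1 - 2^-1 ^+ j).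
  elim: j => [|j IH]; first by rewrite addn0 expr0 !subrr normr0 mulr0.
  rewrite addnS -[x (k + j).+1](subrK (x (k + j)%N)) -addrA.
  apply: le_trans (ler_normD _ _) _; apply: le_trans (lerD (H _) IH) _.
  rewrite exprD !exprVn exprS.
  have : (2 : R) ^+ k != 0 by rewrite expf_neq0.
  have : (2 : R) ^+ j != 0 by rewrite expf_neq0.
  move: (2 ^+ k) (2 ^+ j) => p q q0 p0; rewrite le_eqVlt; apply/orP; left; apply/eqP.
  by field; rewrite p0 q0.
have bd' k m : (k <= m)%N -> `|x m - x k| <= 2 * a / 2 ^+ k.
  move=> km; rewrite -(subnKC km); apply: le_trans (bd _ _) _.
  by rewrite ler_piMr// ?divr_ge0 ?mulr_ge0 ?exprn_ge0// gerBl exprn_ge0// invr_ge0.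
have /choice[y yP] n : exists y : R, x k n @[k --> \oo] --> y.
  suff : cvgn (fun k => x k n) by move=> /cvg_ex.
  rewrite (_ : (fun k => x k n) = (fun k => x 0%N n + series (telescope (fun k => x
    k n)) k)); last first.
    by apply/funext => k; rewrite -eq_sum_telescope.
  apply: is_cvgD; first exact: is_cvg_cst.
  apply: normed_cvg; apply: series_le_cvg (@is_cvg_geometric_series _ a 2^-1 _).
  - by move=> k; rewrite normr_ge0.
  - by move=> k; rewrite /geometric/= mulr_ge0// exprn_ge0// invr_ge0.
  - by move=> k; rewrite /telescope /geometric /= exprVn (le_trans (coord_le (x
    k.+1 - x k) n)).
  - by rewrite ger0_norm ?invr_ge0// invf_lt1// ltr1n.
(* For fixed [A] the limit in m involves finitely many coordinates, and the bound does not depend on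
   [A]. *)
have yb k (A : {fset T}) : \sum_(n <- A) (y n - x k n) ^+ 2 <= (2 * a / 2 ^+ k) ^+ 2.
  apply: (@cvgr_to_le _ \oo _ R (fun m => \sum_(n <- A) (x m n - x k n) ^+ 2)).
    apply: cvg_big => [|n _]; first exact: add_continuous.
    have c : (fun m => x m n - x k n) @ \oo --> y n - x k n.
      by apply: cvgB; [exact: yP|exact: cvg_cst].
    by under eq_fun do rewrite expr2; rewrite expr2; exact: cvgM.
  exists k => // m /= km; apply: le_trans (fset_le_norm (x m - x k) A) _.
  by rewrite ler_pXn2r ?nnegrE// ?bd'// divr_ge0// ?mulr_ge0// exprn_ge0.
have nn k : 0 <= 2 * a / 2 ^+ k by rewrite divr_ge0// ?mulr_ge0// exprn_ge0.
have sy : mkl2 (fun n => y n - x 0%N n) = (fun n => y n - x 0%N n) :> (T -> R).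
  by have [] := mkl2_ub (nn 0%N) (yb 0%N).
exists (mkl2 (fun n => y n - x 0%N n) + x 0%N) => k; apply: norm_ub => // A.
rewrite (eq_bigr (fun n => (y n - x k n) ^+ 2)) => [|n _]; first exact: yb.
by rewrite l2B l2D sy subrK.
Qed.

End Primitives.

(** * Global solutions of Lipschitz systems *)

Lemma geometric_small (R : realType) (c e : R) : 0 < e -> exists k : nat, c / 2 ^+
  k < e.
Proof.
move=> e0; exists (Num.bound (`|c| / e)).
rewrite ltr_pdivrMr ?exprn_gt0// -ltr_pdivrMl// mulrC.
apply: le_lt_trans (_ : _ <= `|c| / e) _; first by rewrite ler_wpM2r ?invr_ge0
  ?(ltW e0)// ler_norm.
apply: lt_trans (archi_boundP _) _; first by rewrite divr_ge0// ltW.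
by rewrite -natrX ltr_nat ltn_expl.
Qed.

Lemma is_derive_exp (R : realType) (c t : R) :
  is_derive t 1 (fun s => expR (c * s)) (c * expR (c * t)).
Proof.
have d : is_derive t (1 : R) (fun s : R => c * s) c.
  by rewrite -[X in is_derive _ _ _ X]mulr1; apply: is_derive_mull;
    exact: is_derive_id.
by rewrite mulrC; exact: (is_derive1_comp (is_derive_expR (c * t)) d).
Qed.

Lemma clamp_continuous (R : realType) : continuous (fun s : R => Num.max s 0).
Proof.
apply: (@lip_continuous _ R R _ 1) => x y; rewrite mul1r.
have := ler_norm (x - y); have := ler_norm (y - x); rewrite (distrC y x).
by case: (leP x 0) => x0; case: (leP y 0) => y0; rewrite ler_norml => h1 h2;
  apply/andP; split; lra.
Qed.

Lemma norm_fst_le (R : realType) (W : normedModType R) (p : W * W) : `|p.1| <= `|p|.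
Proof. by rewrite prod_normE le_max lexx. Qed.

Lemma norm_snd_le (R : realType) (W : normedModType R) (p : W * W) : `|p.2| <= `|p|.
Proof. by rewrite prod_normE le_max lexx orbT. Qed.

Lemma pair_continuous (R : realType) (W : normedModType R) (u w : R -> W) (t : R) :
  {for t, continuous u} -> {for t, continuous w} ->
  {for t, continuous (fun s => (u s, w s))}.
Proof.
move=> /cvgrPdist_lt cu /cvgrPdist_lt cw; apply/cvgrPdist_lt => e e0; near=> s.
by rewrite prod_normE gt_max; apply/andP; split; near: s; [exact: cu|exact: cw].
Unshelve. all: by end_near. Qed.

Lemma norm_telescope3 (R : realType) (W : normedModType R) (a b c d : W) (e : R) :
  `|a - b| <= e / 3 -> `|b - c| <= e / 3 -> `|d - c| <= e / 3 -> `|a - d| <= e.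
Proof.
have -> : a - d = (a - b) + (b - c) - (d - c) by rewrite opprB !addrA !subrK.
have := ler_normB (a - b + (b - c)) (d - c); have := ler_normD (a - b) (b - c); lra.
Qed.

Lemma norm_sub_le_common (R : realType) (W : normedModType R) (a b c : W) (e : R) :
  `|a - c| <= e -> `|b - c| <= e -> `|a - b| <= e + e.
Proof. by move=> ac bc; rewrite (le_trans (ler_distD c _ _))// (distrC c) lerD. Qed.

Section Picard.
Context {R : realType} {T : choiceType}.
Local Notation V := (l2 R T).
Variables (g : V -> V -> V) (L : R) (x0 y0 : V).
Hypothesis L1 : 1 <= L.
Hypothesis gL : forall x y x' y', `|g x y - g x' y'| <= L * (`|x - x'| + `|y - y'|).
Implicit Types (p q : R -> V * V).

Let cont p := forall t : R, 0 <= t -> {for t, continuous p}.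
Let step p q := q 0 = (x0, y0) /\ forall t : R, 0 <= t ->
  is_derive t 1 (fun s => (q s).1) (p t).2 /\
  is_derive t 1 (fun s => (q s).2) (g (p t).1 (p t).2).

(** The premise [cont p] stands under the existential so that [choice] yields a map defined on all
    curves. The curve is frozen at its initial value for negative times, because [primitive_l2]
    integrates curves that are continuous on the whole line. *)
Let step_ex p : exists q, cont p -> cont q /\ step p q.
Proof.
have [cp|] := pselect (cont p); last by move=> ncp; exists p.
pose pc s := p (Num.max s 0).
have cpc : continuous pc.
  move=> s; apply: (@cvg_comp _ _ _ (fun s : R => Num.max s 0) p);
    first exact: clamp_continuous.
  by apply: cp; rewrite le_max lexx orbT.
have c2 : continuous (fun s => (pc s).2).
  have cs : continuous (snd : V * V -> V).
    by apply: (@lip_continuous _ _ _ _ 1) => x y; rewrite mul1r;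
      exact: (norm_snd_le (x - y)).
  by move=> s; apply: continuous_comp; [exact: cpc|exact: cs].
have cg : continuous (fun s => g (pc s).1 (pc s).2).
  have cG : continuous (fun p : V * V => g p.1 p.2).
    apply: (@lip_continuous _ _ _ _ (2 * L)) => x y.
    apply: le_trans (gL _ _ _ _) _; rewrite (mulrC 2) -mulrA ler_wpM2l ?(le_trans _
      L1)//.
    by rewrite mulr_natl mulr2n lerD// ?(norm_fst_le (x - y)) ?(norm_snd_le (x - y)).
  by move=> s; apply: (@continuous_comp _ _ _ pc (fun p : V * V => g p.1 p.2));
    [exact: cpc|exact: cG].
have [u u0 du] := primitive_l2 x0 c2; have [w w0 dw] := primitive_l2 y0 cg.
have tpos (t : R) : 0 <= t -> -1 < t by move=> ?; lra.
have pcE (t : R) : 0 <= t -> pc t = p t by move=> t0; rewrite /pc max_l.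
exists (fun t => (u t, w t)) => _; split.
  move=> t /tpos t1; apply: pair_continuous; [exact: is_derive_cont (du _
    t1)|exact: is_derive_cont (dw _ t1)].
split; first by rewrite u0 w0.
by move=> t t0; rewrite -(pcE t t0); split; [apply: du|apply: dw]; exact: tpos.
Qed.

(** The norm of a pair is the larger of the two norms, so each component of the difference has
    velocity at most 2L |p - p'|. Integrating the weight gains 1/(4L), and the product of the two
    constants is 1/2. *)
Let contract p p' q q' (a : R) : step p q -> step p' q' ->
  (forall t : R, 0 <= t -> `|p t - p' t| <= a * expR (4 * L * t)) ->
  forall t : R, 0 <= t -> `|q t - q' t| <= a / 2 * expR (4 * L * t).
Proof.
move=> [q0 dq] [q'0 dq'] pp t t0.
have a0 : 0 <= a.
  by have := le_trans (normr_ge0 _) (pp 0 (lexx 0)); rewrite mulr0 expR0 mulr1.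
have L0 : 0 <= L by rewrite (le_trans _ L1).
have ck : {within `[0, t], continuous (fun s => a / 2 * expR (4 * L * s))}.
  apply: continuous_subspaceT => s.
  exact: is_derive_cont (is_derive_mull (a / 2) (is_derive_exp (4 * L) s)).
have dk (s : R) : is_derive s 1 (fun s => a / 2 * expR (4 * L * s)) (2 * L * (a *
  expR (4 * L * s))).
  rewrite (_ : 2 * L * _ = a / 2 * (4 * L * expR (4 * L * s))); last by field.
  exact: is_derive_mull (is_derive_exp (4 * L) s).
have fin (u v : R -> V) : u 0 = 0 ->
    (forall s : R, 0 <= s -> is_derive s 1 u (v s)) ->
    (forall s : R, 0 <= s -> `|v s| <= 2 * L * `|p s - p' s|) ->
    `|u t| <= a / 2 * expR (4 * L * t).
  move=> u0 du vb.
  have cu : {within `[0, t], continuous u}.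
    apply: derivable_within_continuous => s; rewrite in_itv/= => /andP[s0 _].
    by have [] := du s s0.
  have := @norm_increment_le _ _ u v _ _ 0 t t0 cu ck _ (fun s _ => dk s) _.
  rewrite u0 subr0 => H; apply: le_trans (H _ _) _.
  - by move=> s /andP[/ltW s0 _]; exact: du.
  - move=> s /andP[/ltW s0 _]; apply: le_trans (vb _ s0) _.
    by rewrite ler_wpM2l ?mulr_ge0// pp.
  - by rewrite gerBl mulr_ge0 ?expR_ge0// divr_ge0.
rewrite prod_normE ge_max; apply/andP; split.
- apply: (fin (fun s => (q s).1 - (q' s).1) (fun s => (p s).2 - (p' s).2)).
  + by rewrite q0 q'0 subrr.
  + by move=> s s0; apply: is_derive_sub; [have [] := dq s s0|have [] := dq' s s0].
  + move=> s s0; apply: le_trans (norm_snd_le (p s - p' s)) _.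
    have L2 : 1 <= 2 * L by move: L1; lra.
    by rewrite ler_peMl.
- apply: (fin (fun s => (q s).2 - (q' s).2) (fun s => g (p s).1 (p s).2 - g (p'
  s).1 (p' s).2)).
  + by rewrite q0 q'0 subrr.
  + by move=> s s0; apply: is_derive_sub; [have [] := dq s s0|have [] := dq' s s0].
  + move=> s s0; apply: le_trans (gL _ _ _ _) _;
    rewrite (mulrC 2) -mulrA ler_wpM2l//.
    by rewrite mulr_natl mulr2n lerD// ?(norm_fst_le (p s - p' s)) ?(norm_snd_le (p
      s - p' s)).
Qed.

(* With the weight [expR (4 * L * t)] the iteration contracts by 1/2 on the
   whole half-line. *)
Theorem picard : exists x y : R -> V,
  [/\ x 0 = x0, y 0 = y0 & forall t : R, 0 <= t ->
    is_derive t 1 x (y t) /\ is_derive t 1 y (g (x t) (y t))].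
Proof.
have [f fP] := choice step_ex.
pose P k := iter k f (fun=> (x0, y0)).
have cP k : cont (P k).
  elim: k => [|k IH]; last by have [] := fP _ IH.
  by move=> t _; exact: cst_continuous.
have sP k : step (P k) (P k.+1) by have [] := fP _ (cP k).
(* The zeroth iterate is constant, so the first one moves with the constant velocities [y0] and
   [g x0 y0], which [M] bounds. *)
pose M := `|y0| + `|g x0 y0|.
have L0 : 0 <= L by rewrite (le_trans _ L1).
have bP k : forall t : R, 0 <= t -> `|P k.+1 t - P k t| <= M / 2 ^+ k * expR (4 * L
  * t).
  elim: k => [|k IH]; last first.
    move=> t t0; rewrite exprSr invfM mulrA.
    exact: (contract (sP k.+1) (sP k)).
  move=> t t0; rewrite expr0 divr1 /=.
  have fin (u : R -> V) (u' a : V) : u 0 = a -> `|u'| <= M ->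
      (forall s : R, 0 <= s -> is_derive s 1 u u') -> `|u t - a| <= M * expR (4 * L
        * t).
    move=> <- uM du.
    apply: (@le_trans _ _ (M * t - M * 0)).
      apply: (@norm_increment_le _ _ u (fun=> u') (fun s => M * s) (fun=> M)) => //.
      - apply: derivable_within_continuous => s; rewrite in_itv/= => /andP[s0 _].
        by have [] := du s s0.
      - by apply: continuous_subspaceT => s; apply: mulrl_continuous.
      - by move=> s /andP[/ltW s0 _]; exact: du.
      - by move=> s _; rewrite -[X in is_derive _ _ _ X]mulr1;
        apply: is_derive_mull; exact: is_derive_id.
    rewrite mulr0 subr0 ler_wpM2l// ?addr_ge0//.
    have L4 : 1 <= 4 * L by move: L1; lra.
    apply: le_trans (_ : 4 * L * t <= _); first by rewrite ler_peMl.
    by apply: le_trans (expR_ge1Dx _); rewrite lerDr.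
  have [e0 d0] := sP 0%N.
  rewrite prod_normE ge_max; apply/andP; split.
  - apply: (fin (fun s => (P 1%N s).1) y0); first by rewrite e0.
      by rewrite lerDl.
    by move=> s s0; have [] := d0 s s0.
  - apply: (fin (fun s => (P 1%N s).2) (g x0 y0)); first by rewrite e0.
      by rewrite lerDr.
    by move=> s s0; have [] := d0 s s0.
have [Q QP] : exists Q : R -> V * V, forall t : R, 0 <= t -> forall k,
    `|Q t - P k t| <= 2 * M / 2 ^+ k * expR (4 * L * t).
  suff /choice[Q QP] t : exists z : V * V, 0 <= t -> forall k,
      `|z - P k t| <= 2 * M / 2 ^+ k * expR (4 * L * t) by exists Q.
  have [t0|_] := leP 0 t; last by exists 0.
  have [|x xP] := @geometric_cvg _ _ (fun k => (P k t).1) (M * expR (4 * L * t)).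
    by move=> k; rewrite mulrAC; apply: le_trans (bP k t t0);
      exact: (norm_fst_le (P k.+1 t - P k t)).
  have [|y yP] := @geometric_cvg _ _ (fun k => (P k t).2) (M * expR (4 * L * t)).
    by move=> k; rewrite mulrAC; apply: le_trans (bP k t t0);
      exact: (norm_snd_le (P k.+1 t - P k t)).
  exists (x, y) => _ k; rewrite prod_normE ge_max mulrAC -(mulrA 2 M); apply/andP.
  by split; [exact: xP|exact: yP].
(* The iterates are controlled for t >= 0 only; clamping the time makes the limit continuous at 0
   from both sides. *)
pose Qc s := Q (Num.max s 0).
have cQ : cont Qc.
  move=> t t0; apply/cvgrPdist_le => e e0.
  pose E := expR (4 * L * (t + 1)).
  have E0 : 0 < E by exact: expR_gt0.
  have e3 : 0 < e / 3 / E by rewrite !divr_gt0.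
  have [k kP] := geometric_small (2 * M) e3.
  have QE (s : R) : 0 <= s -> s <= t + 1 -> `|Q s - P k s| <= e / 3.
    move=> s0 st; apply: le_trans (QP s s0 k) _.
    rewrite -(@ler_pdivlMr _ (expR _)) ?expR_gt0//; apply: le_trans (ltW kP) _.
    rewrite ler_pM2l ?divr_gt0// lef_pV2 ?posrE ?expR_gt0// ler_expR.
    by rewrite ler_wpM2l// ?mulr_ge0.
  have cPt : (P k (Num.max s 0)) @[s --> t] --> P k (Num.max t 0).
    apply: (@cvg_comp _ _ _ (fun s : R => Num.max s 0) (P k));
      first exact: clamp_continuous.
    by apply: cP; rewrite le_max lexx orbT.
  have e3' : 0 < e / 3 by rewrite divr_gt0.
  near=> s.
  have s1 : s <= t + 1.
    near: s; exists 1 => //= s /=; rewrite ltr_norml => /andP[]; lra.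
  have m1 (r : R) : r <= t + 1 -> Num.max r 0 <= t + 1 by rewrite ge_max => ->/=;
    lra.
  have m0 (r : R) : 0 <= Num.max r 0 by rewrite le_max lexx orbT.
  have h1 : `|Qc t - P k (Num.max t 0)| <= e / 3 by apply: QE => //; apply: m1; lra.
  have h2 : `|Qc s - P k (Num.max s 0)| <= e / 3 by apply: QE => //; exact: m1.
  have h3 : `|P k (Num.max t 0) - P k (Num.max s 0)| <= e / 3.
    by near: s; move/cvgrPdist_le : cPt; exact.
  exact: (norm_telescope3 h1 h3 h2).
have [_ [q0 dq]] := fP _ cQ.
(* Both curves are within a multiple of 2^-k of the iterate [P k.+1], for every k. *)
have qE (t : R) : 0 <= t -> f Qc t = Qc t.
  move=> t0; apply/eqP; rewrite -subr_eq0 -normr_le0 leNgt; apply/negP => pos.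
  have QcE (s : R) : 0 <= s -> Qc s = Q s by move=> s0; rewrite /Qc max_l.
  pose E := expR (4 * L * t).
  have E0 : 0 < E by exact: expR_gt0.
  have [k kP] := @geometric_small _ (2 * M) (`|f Qc t - Qc t| / (2 * E)) (divr_gt0
    pos (mulr_gt0 (ltr0Sn _ 1) E0)).
  have h1 : `|f Qc t - P k.+1 t| <= 2 * M / 2 ^+ k / 2 * E.
    apply: (contract (conj q0 dq) (sP k)) => // s s0.
    by rewrite QcE//; exact: QP.
  have h2 : `|Qc t - P k.+1 t| <= 2 * M / 2 ^+ k / 2 * E.
    have := QP t t0 k.+1; rewrite exprSr invfM mulrA -(QcE t t0).
    exact.
  have h3 : `|f Qc t - Qc t| <= 2 * M / 2 ^+ k * E.
    rewrite [X in _ <= X](_ : _ = 2 * M / 2 ^+ k / 2 * E + 2 * M / 2 ^+ k / 2 * E);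
      last by field.
    exact: (norm_sub_le_common h1 h2).
  have : `|f Qc t - Qc t| < `|f Qc t - Qc t| / (2 * E) * E.
    by apply: le_lt_trans h3 _; rewrite ltr_pM2r.
  rewrite (_ : _ / _ * E = `|f Qc t - Qc t| / 2); last by field; rewrite gt_eqF.
  by rewrite ltNge ler_pdivrMr// ler_peMr// ler1n.
(* The image [f Qc] is returned and not [Qc]: they agree for t >= 0 only, and the derivative at 0 is
   two-sided. *)
exists (fun t => (f Qc t).1), (fun t => (f Qc t).2); rewrite q0; split => // t t0.
by rewrite !qE//; exact: dq.
Unshelve. all: by end_near. Qed.

End Picard.

(** * Operators on the lattice *)

Section Lattice.
Context {R : realType} {N : nat}.
Local Notation Z := 'rV[int]_N.
Local Notation V := (l2 R 'rV[int]_N).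
Implicit Types (x y : V) (e : Z).

Lemma translate_bij e : bijective (fun n : Z => n + e).
Proof. by exists (fun n => n - e) => n; rewrite ?addrK ?subrK. Qed.

Definition shift_l2 e x : V := mkl2 (fun n => x (n + e)).

Lemma shiftE e x n : shift_l2 e x n = x (n + e).
Proof.
rewrite mkl2E//; apply: (@summ_reindex _ _ _ (fun n => n + e) (fun n => x n ^+ 2)).
  exact: bij_inj (translate_bij e).
exact: l2P.
Qed.

Lemma shiftD e x y : shift_l2 e (x + y) = shift_l2 e x + shift_l2 e y.
Proof. by apply: l2_ext => n; rewrite l2E !shiftE. Qed.

Lemma shiftB e x y : shift_l2 e (x - y) = shift_l2 e x - shift_l2 e y.
Proof. by apply: l2_ext => n; rewrite l2B !shiftE. Qed.

Lemma shiftZ e (a : R) x : shift_l2 e (a *: x) = a *: shift_l2 e x.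
Proof. by apply: l2_ext => n; rewrite l2E !shiftE. Qed.

Lemma shift_shift e e' x : shift_l2 e (shift_l2 e' x) = shift_l2 (e + e') x.
Proof. by apply: l2_ext => n; rewrite !shiftE addrA. Qed.

Lemma shift_comm e e' x : shift_l2 e (shift_l2 e' x) = shift_l2 e' (shift_l2 e x).
Proof. by rewrite !shift_shift addrC. Qed.

Lemma shift0 x : shift_l2 0 x = x.
Proof. by apply: l2_ext => n; rewrite shiftE addr0. Qed.

Lemma dot_shift e x y : dot (shift_l2 e x) (shift_l2 e y) = dot x y.
Proof.
rewrite /dot -(tsum_reindex (fun n => x n * y n) (translate_bij e)).
by congr tsum; apply/funext => n /=; rewrite !shiftE.
Qed.

Lemma norm_shift e x : `|shift_l2 e x| = `|x|.
Proof.
by apply/eqP; rewrite -(@eqrXn2 _ 2)// -!dotxx dot_shift.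
Qed.

Definition grad k x : V := shift_l2 (unit_vec k) x - x.

Definition gradsq x : R := \sum_(k < N) `|grad k x| ^+ 2.

Definition lap x : V :=
  \sum_(k < N) (shift_l2 (unit_vec k) x + shift_l2 (- unit_vec k) x - 2 *: x).

Lemma l2_sumE (I : Type) (r : seq I) (F : I -> V) n :
  (\sum_(i <- r) F i) n = \sum_(i <- r) F i n.
Proof. by elim: r => [|i r IH]; rewrite ?big_nil// !big_cons l2E IH. Qed.

Lemma lapE x : lap x = dlap x :> (Z -> R).
Proof.
apply/funext => n; rewrite /lap l2_sumE; apply: eq_bigr => k _.
by rewrite !l2E !shiftE.
Qed.

Lemma lapB x y : lap (x - y) = lap x - lap y.
Proof.
rewrite -sumrB; apply: eq_bigr => k _; apply: l2_ext => n.
by rewrite !shiftB scalerBr !l2E; ring.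
Qed.

Lemma norm_lap x : `|lap x| <= (4 * N%:R) * `|x|.
Proof.
apply: le_trans (ler_norm_sum _ _ _) _.
apply: (@le_trans _ _ (\sum_(k < N) (4 * `|x|))); last first.
  by rewrite sumr_const card_ord -[leLHS]mulr_natr mulrAC.
apply: ler_sum => k _; apply: le_trans (ler_normB _ _) _.
apply: le_trans (lerD (ler_normD _ _) (lexx _)) _.
by rewrite !norm_shift normrZ ger0_norm//; lra.
Qed.

Lemma dot_lap x y : dot (lap x) y = - \sum_(k < N) dot (grad k x) (grad k y).
Proof.
rewrite /lap dot_suml -sumrN; apply: eq_bigr => k _.
rewrite /grad !(dotBl, dotBr, dotDl, dotZl) dot_shift.
(* Translations are isometries, so the adjoint of a translation is its inverse; the identity is a
   summation by parts. *)
have -> : dot (shift_l2 (- unit_vec k) x) y = dot x (shift_l2 (unit_vec k) y).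
  by rewrite -(dot_shift (unit_vec k)) shift_shift subrr shift0.
by ring.
Qed.

Lemma gradB k x y : grad k (x - y) = grad k x - grad k y.
Proof. by rewrite /grad shiftB; apply: l2_ext => n; rewrite !l2E; ring. Qed.

Lemma gradZ k (a : R) x : grad k (a *: x) = a *: grad k x.
Proof. by rewrite /grad shiftZ scalerBr. Qed.

Lemma norm_grad k x : `|grad k x| <= 2 * `|x|.
Proof. by apply: le_trans (ler_normB _ _) _; rewrite norm_shift; lra. Qed.

Lemma gradsq_ge0 x : 0 <= gradsq x.
Proof. by apply: sumr_ge0 => k _; rewrite sqr_ge0. Qed.

Lemma norm_grad_le k x : `|grad k x| ^+ 2 <= gradsq x.
Proof. by rewrite /gradsq (bigD1 k)//= lerDl sumr_ge0// => *; rewrite sqr_ge0. Qed.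

Lemma is_derive_gradsq (u : R -> V) (t : R) (w : V) : is_derive t 1 u w ->
  is_derive t 1 (fun s => gradsq (u s)) (- 2 * dot (lap (u t)) w).
Proof.
move=> du; rewrite dot_lap mulrNN mulr_sumr.
apply: (@is_derive_bigsum _ _ _ R (fun k s => `|grad k (u s)| ^+ 2)) => k.
have dk : is_derive t 1 (fun s => grad k (u s)) (grad k w).
  by apply: (@is_derive_lin _ _ _ (grad k) 2) du;
    [exact: gradB|exact: gradZ|exact: norm_grad].
have := is_derive_dot dk dk; under eq_fun do rewrite dotxx.
by move/is_derive_eq; apply; rewrite (dotC (grad k w)); ring.
Qed.

(** * Comparison with the norms of the statement *)

Lemma l2normE x : l2norm x = `|x|.
Proof.
rewrite /l2norm /lpnorm; have -> : lsum (fun n => `|x n| `^ 2) = `|x| ^+ 2.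
  rewrite normrE_sqr /lsum -/(tsum _); congr tsum; apply/funext => n.
  by rewrite powR_mulrn// real_normK// num_real.
by rewrite powR12_sqrt ?sqr_ge0// sqrtr_sqr normr_id.
Qed.

Lemma grad_normsqE x : grad_normsq x = gradsq x.
Proof.
apply: eq_bigr => k _; congr (_ ^+ 2); rewrite -l2normE; congr l2norm.
by apply/funext => n; rewrite l2B shiftE.
Qed.

Lemma lp2E (f : Z -> R) : lp 2 f <-> sqsumm f.
Proof.
rewrite /lp /sqsumm /summ /=.
have -> : (fun n => (`|f n| `^ 2)%:E) = EFin \o (fun n => f n ^+ 2).
  by apply/funext => n; rewrite /= powR_mulrn// real_normK// num_real.
by [].
Qed.

(** The number of translates is [m.+1], so that the division is always legitimate. *)
Definition avg e (m : nat) x : V := m.+1%:R^-1 *: \sum_(j < m.+1) shift_l2 (e *+ j)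
  x.

Section Average.
Variables (e : Z) (m : nat).

Lemma avgB x y : avg e m (x - y) = avg e m x - avg e m y.
Proof. by rewrite /avg -scalerBr -sumrB; congr (_ *: _); apply: eq_bigr => j _;
  rewrite shiftB. Qed.

Lemma avgZ (a : R) x : avg e m (a *: x) = a *: avg e m x.
Proof.
rewrite /avg scalerA (mulrC a) -scalerA [a *: _ in RHS]scaler_sumr; congr (_ *: _).
by apply: eq_bigr => j _; rewrite shiftZ.
Qed.

Lemma norm_avg x : `|avg e m x| <= `|x|.
Proof.
rewrite /avg normrZ ger0_norm ?invr_ge0// mulrC ler_pdivrMr ?ltr0n//.
apply: le_trans (ler_norm_sum _ _ _) _.
under eq_bigr do rewrite norm_shift.
by rewrite sumr_const card_ord mulr_natr.
Qed.

Lemma avg_shift e' x : avg e m (shift_l2 e' x) = shift_l2 e' (avg e m x).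
Proof.
rewrite /avg shiftZ; congr (_ *: _).
elim/big_rec2 : _ => [|j a b _ ->]; last by rewrite shiftD shift_comm.
by apply: l2_ext => n; rewrite shiftE.
Qed.

Lemma avgD x y : avg e m (x + y) = avg e m x + avg e m y.
Proof.
rewrite /avg -scalerDr -big_split; congr (_ *: _).
by apply: eq_bigr => j _; rewrite shiftD.
Qed.

Lemma avg_lap x : avg e m (lap x) = lap (avg e m x).
Proof.
rewrite /lap.
have -> : avg e m (\sum_(k < N) (shift_l2 (unit_vec k) x + shift_l2 (- unit_vec k)
  x - 2 *: x))
  = \sum_(k < N) avg e m (shift_l2 (unit_vec k) x + shift_l2 (- unit_vec k) x - 2
    *: x).
  elim/big_rec2 : _ => [|k a b _ <-]; last by rewrite avgD.
  by rewrite -(scale0r (0 : V)) avgZ !scale0r.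
by apply: eq_bigr => k _; rewrite avgB avgD avgZ !avg_shift.
Qed.

(** The translate by [e *+ j] is reached in j unit steps, each of which changes [x] by the same
    norm, and j <= m. *)
Lemma norm_sub_avg x : `|x - avg e m x| <= m.+1%:R * `|shift_l2 e x - x|.
Proof.
have st j : `|shift_l2 (e *+ j) x - x| <= j%:R * `|shift_l2 e x - x|.
  elim: j => [|j IH]; first by rewrite mulr0n shift0 subrr normr0 mul0r.
  rewrite -[shift_l2 (e *+ j.+1) x](subrK (shift_l2 (e *+ j) x)) -addrA.
  apply: le_trans (ler_normD _ _) _; rewrite -natr1 mulrDl mul1r [leRHS]addrC lerD//.
  by rewrite mulrSr -shift_shift -shiftB norm_shift.
rewrite distrC.
have -> : avg e m x - x = m.+1%:R^-1 *: \sum_(j < m.+1) (shift_l2 (e *+ j) x - x).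
  rewrite sumrB scalerBr sumr_const card_ord -[x *+ _]scaler_nat scalerA mulVf
    ?scale1r//.
rewrite normrZ ger0_norm ?invr_ge0// mulrC ler_pdivrMr ?ltr0n//.
apply: le_trans (ler_norm_sum _ _ _) _.
apply: (@le_trans _ _ (\sum_(j < m.+1) m.+1%:R * `|shift_l2 e x - x|)).
  apply: ler_sum => j _; apply: le_trans (st j) _.
  by rewrite ler_wpM2r// ler_nat ltnW.
by rewrite sumr_const card_ord mulr_natr.
Qed.

End Average.

(* The translates of a unit mass are orthonormal, so averaging k of them
   divides the norm by [sqrt k]. *)
Lemma norm_avg_delta e m (n : Z) (c : R) : (forall j : nat, e *+ j = 0 -> j = 0%N) ->
  `|avg e m (restr [fset n]%fset (fun=> c))| ^+ 2 = c ^+ 2 / m.+1%:R.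
Proof.
move=> e0; set d := restr _ _.
have dE k : d k = if k == n then c else 0 by rewrite /d restrE in_fset1.
have dd (i j : nat) : dot (shift_l2 (e *+ i) d) (shift_l2 (e *+ j) d) = if i == j
  then c ^+ 2 else 0.
  case: eqP => [->|ij].
    rewrite dot_shift dotxx /d norm_restr big_seq_fset1//.
  rewrite /dot (_ : (fun k => _) = fun=> 0); first by rewrite tsum_ge0E// esum1.
  apply/funext => k.
  rewrite (shiftE (e *+ i)).
  rewrite (shiftE (e *+ j)).
  rewrite (dE (k + e *+ i)).
  rewrite (dE (k + e *+ j)).
  have [h1|_] := eqVneq (k + e *+ i) n; last exact: mul0r.
  have [h2|_] := eqVneq (k + e *+ j) n; last exact: mulr0.
  case: ij; have : e *+ i = e *+ j by apply: (addrI k); rewrite h1 h2.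
  move: h1 h2 => _ _; wlog ij : i j / (i <= j)%N.
    by move=> H h; case/orP: (leq_total i j) => [|/H]; [move/H;
      exact|move=> /(_ (esym h)) ->].
  move=> h; apply/eqP; rewrite eqn_leq ij/= -subn_eq0; apply/eqP/e0.
  by rewrite mulrnBr// h subrr.
rewrite -dotxx /avg dotZl dotZr.
rewrite dot_suml; under eq_bigr => i _.
  rewrite dotC dot_suml (bigD1 i)//= dd eqxx big1 ?addr0; last first.
    by move=> j ji; rewrite dd ifF//; apply/negbTE; rewrite -(inj_eq val_inj) in ji.
  over.
rewrite sumr_const card_ord -mulr_natr; field.
by rewrite nat1r pnatr_eq0.
Qed.

(** An instance of the mean ergodic theorem, for a translation of infinite order. Finitely supported
    elements are dense and [avg] contracts the norm, so that unit masses suffice. *)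
Lemma avg_cvg0 e x : (forall j : nat, e *+ j = 0 -> j = 0%N) ->
  forall eps : R, 0 < eps -> exists m, `|avg e m x| < eps.
Proof.
move=> e0 eps eps0; have eps2 : 0 < eps / 2 by rewrite divr_gt0.
have [A xA] := restr_approx x eps2.
pose S := \sum_(n <- A) `|x n|.
have S0 : 0 <= S by apply: sumr_ge0.
have avgA m : `|avg e m (restr A x)| <= S * Num.sqrt m.+1%:R^-1.
  have -> : restr A x = \sum_(n <- A) restr [fset n]%fset (fun=> x n).
    apply: l2_ext => k; rewrite l2_sumE restrE.
    under eq_bigr do rewrite restrE in_fset1; case: ifPn => kA.
      rewrite (big_fsetD1 k)//= eqxx big1_fset ?addr0// => n.
      by rewrite in_fsetD1 eq_sym => /andP[/negbTE ->].
    rewrite big1_fset// => n nA _; case: eqP => [kn|//].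
    by move: kA; rewrite kn nA.
  rewrite /S mulr_suml; elim/big_rec2 : _ => [|n a b _ ab].
    by rewrite -(scale0r (0 : V)) avgZ scale0r normr0.
  rewrite avgD; apply: le_trans (ler_normD _ _) _; apply: lerD => //.
  rewrite -(@ler_pXn2r _ 2)// ?nnegrE// ?mulr_ge0// ?sqrtr_ge0//.
  rewrite norm_avg_delta// exprMn sqr_sqrtr ?invr_ge0//.
  by rewrite real_normK ?num_real.
exists (Num.bound (S ^+ 2 / (eps / 2) ^+ 2)); set m := Num.bound _.
have mb : S * Num.sqrt m.+1%:R^-1 < eps / 2.
  rewrite -(@ltr_pXn2r _ 2)// ?nnegrE ?mulr_ge0 ?sqrtr_ge0 ?(ltW eps0)//.
  rewrite exprMn sqr_sqrtr ?invr_ge0// ltr_pdivrMr ?ltr0n//.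
  rewrite -ltr_pdivrMl ?exprn_gt0// mulrC.
  apply: lt_trans (archi_boundP _) _; first by rewrite divr_ge0// exprn_ge0// ltW.
  by rewrite ltr_nat.
rewrite -[x](subrK (restr A x)) avgD; apply: le_lt_trans (ler_normD _ _) _.
rewrite [eps]splitr; apply: ltrD; last exact: le_lt_trans (avgA m) mb.
exact: le_lt_trans (norm_avg _ _ _) xA.
Qed.

End Lattice.

(** * The power nonlinearity *)

Section PowerNonlinearity.
Context {R : realType}.
Variable p : R.
Hypothesis p0 : 0 < p.
Implicit Types a b u r : R.

Definition oddpow u := `|u| `^ p * u.
Definition abspow u := `|u| `^ (p + 2).

Lemma oddpowN u : oddpow (- u) = - oddpow u.
Proof. by rewrite /oddpow normrN mulrN. Qed.

Lemma oddpow0 : oddpow 0 = 0.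
Proof. by rewrite /oddpow mulr0. Qed.

Lemma oddpow_ge0E u : 0 <= u -> oddpow u = u `^ (p + 1).
Proof.
move=> u0; rewrite /oddpow ger0_norm// powRD ?powRr1//.
by apply/implyP => /eqP h; move: p0; lra.
Qed.

Lemma abspowE u : abspow u = oddpow u * u.
Proof.
rewrite /abspow /oddpow powRD; last by apply/implyP => /eqP h; move: p0; lra.
by rewrite powR_mulrn// real_normK ?num_real// expr2 mulrA.
Qed.

Lemma abspow_ge0 u : 0 <= abspow u. Proof. exact: powR_ge0. Qed.

Lemma abspow_sqr u : abspow u = `|u| `^ p * u ^+ 2.
Proof. by rewrite abspowE /oddpow expr2 mulrA. Qed.

Lemma le_powp a b : `|a| <= b -> `|a| `^ p <= b `^ p.
Proof.
move=> ab; apply: ge0_ler_powR => //; rewrite ?ltW// nnegrE//.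
exact: le_trans (normr_ge0 a) ab.
Qed.

Let lip_pos a b r : 0 <= b -> b <= a -> a <= r ->
  `|oddpow a - oddpow b| <= (p + 1) * r `^ p * `|a - b|.
Proof.
move=> b0 ba ar; have a0 := le_trans b0 ba; have r0 := le_trans a0 ar.
have mono : oddpow b <= oddpow a.
  rewrite !oddpow_ge0E//; apply: ge0_ler_powR => //; move: p0; lra.
rewrite !ger0_norm ?subr_ge0//.
have p1 : 0 <= p + 1 by move: p0; lra.
have rp : a `^ p <= r `^ p by rewrite -[X in X `^ p](ger0_norm a0) le_powp//
  ger0_norm.
apply: (@le_trans _ _ ((p + 1) * a `^ p * (a - b))); last first.
  by rewrite ler_wpM2r ?subr_ge0// ler_wpM2l.
move: ba; rewrite le_eqVlt => /predU1P[->|ba]; first by rewrite !subrr mulr0.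
(* The derivative of a real power is available at positive points only, so b = 0 is treated
   directly. *)
move: b0; rewrite le_eqVlt => /predU1P[b0|b0].
  rewrite -b0 oddpow0 !subr0 /oddpow ger0_norm// -mulrA ler_peMl ?mulr_ge0
    ?powR_ge0//.
  by move: p0; lra.
have [||c] := @MVT _ (fun x : R => x `^ (p + 1)) (fun x => (p + 1) * x `^ p) b a ba.
- move=> x; rewrite in_itv/= => /andP[bx _].
  by have := @is_derive1_powR R (p + 1) x (lt_trans b0 bx); rewrite addrK.
- apply: derivable_within_continuous => x; rewrite in_itv/= => /andP[bx _].
  by have [] := @is_derive1_powR R (p + 1) x (lt_le_trans b0 bx).
rewrite in_itv/= => /andP[bc ca]; rewrite !oddpow_ge0E ?(ltW b0)// => ->.
rewrite ler_wpM2r ?subr_ge0 ?(ltW ba)// ler_wpM2l//.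
have c0 : 0 <= c by rewrite ltW// (lt_trans b0).
by rewrite -(ger0_norm c0) le_powp// ger0_norm// ltW.
Qed.

Let lip_pos' a b r : 0 <= b -> 0 <= a -> b <= r -> a <= r ->
  `|oddpow a - oddpow b| <= (p + 1) * r `^ p * `|a - b|.
Proof.
move=> b0 a0 br ar; have [ba|/ltW ab] := leP b a; first exact: lip_pos.
by rewrite distrC (distrC a); exact: lip_pos.
Qed.

Lemma oddpow_lip a b r : `|a| <= r -> `|b| <= r ->
  `|oddpow a - oddpow b| <= (p + 1) * r `^ p * `|a - b|.
Proof.
wlog a0 : a b / 0 <= a.
  move=> H ar br; have [|/ltW a0] := leP 0 a; first by move/H; exact.
  have := H (- a) (- b); rewrite oppr_ge0 !oddpowN -!opprD !normrN; exact.
move=> ar br; have a_r : a <= r by rewrite (le_trans (ler_norm _)).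
have r0 := le_trans a0 a_r.
have [b0|/ltW b0] := leP 0 b; first by apply: lip_pos';
  rewrite // (le_trans (ler_norm _)).
(* For opposite signs |a - b| = |a| + |b|, and each of [a] and [b] is compared with 0. *)
have Nb0 : 0 <= - b by rewrite oppr_ge0.
have Nbr : - b <= r by rewrite (le_trans (ler_norm _))// normrN.
have h1 := lip_pos (lexx 0) a0 a_r; have h2 := lip_pos (lexx 0) Nb0 Nbr.
rewrite oddpow0 !subr0 !(ger0_norm a0) in h1; rewrite oddpow0 !subr0 oddpowN normrN
  (ger0_norm Nb0) in h2.
apply: le_trans (ler_normB _ _) _; rewrite (ger0_norm (_ : 0 <= a - b)); last by lra.
by rewrite mulrDr lerD.
Qed.

Lemma oddpow_bound u r : `|u| <= r -> `|oddpow u| <= r `^ p * `|u|.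
Proof. by move=> ur; rewrite /oddpow normrM ger0_norm ?powR_ge0// ler_wpM2r//
  le_powp. Qed.

Lemma is_derive_abspow u : is_derive u 1 abspow ((p + 2) * oddpow u).
Proof.
have pos (v : R) : 0 < v -> is_derive v 1 abspow ((p + 2) * oddpow v).
  move=> v0; have := @is_derive1_powR R (p + 2) v v0.
  rewrite (_ : p + 2 - 1 = p + 1); last by ring.
  rewrite -(oddpow_ge0E (ltW v0)); apply: is_derive_restr.
  exists v => //= s /=; rewrite ltr_norml => /andP[h1 h2].
  by rewrite /abspow ger0_norm//; lra.
have [u0|u0|<-] := ltgtP 0 u; first exact: pos.
  have du : is_derive u (1 : R) (fun s : R => - s) (- 1).
    by apply: is_derive_opp; exact: is_derive_id.
  have Nu0 : 0 < - u by rewrite oppr_gt0.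
  have := is_derive1_comp (pos _ Nu0) du.
  rewrite oddpowN mulrN1 mulrN opprK (_ : abspow \o _ = abspow)//.
  by apply/funext => s; rewrite /abspow /= normrN.
(* At 0 the derivative vanishes, since [abspow p s] is at most (p + 1) s^2 for |s| <= 1. *)
apply/is_derive_epsP => e e0.
have K0 : 0 < p + 1 by move: p0; lra.
exists (Num.min 1 (e / (p + 1))); first by rewrite /= lt_min ltr01 divr_gt0.
move=> s /=; rewrite sub0r normrN lt_min => /andP[s1 se].
rewrite oddpow0 mulr0 scaler0 !subr0 !abspowE oddpow0 mul0r subr0 normrM ler_wpM2r//.
have := @oddpow_lip s 0 1; rewrite normr0 oddpow0 !subr0 powR1 mulr1 => /(_ (ltW
  s1) ler01) h.
by apply: le_trans h _; rewrite mulrC -ler_pdivlMr// ltW.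
Qed.

(** Mean value theorem followed by the Lipschitz bound on the derivative. A remainder quadratic in
    [b - a] is what can be summed over the lattice. *)
Lemma abspow_taylor a b r : `|a| <= r -> `|b| <= r ->
  `|abspow b - abspow a - (p + 2) * oddpow a * (b - a)| <=
    (p + 2) * ((p + 1) * r `^ p) * (b - a) ^+ 2.
Proof.
move=> ar br; have p2 : 0 <= p + 2 by move: p0; lra.
have mv : exists c, [/\ `|c| <= r, `|c - a| <= `|b - a| &
    abspow b - abspow a = (p + 2) * oddpow c * (b - a)].
  have dG := is_derive_abspow.
  have cG x y : {within `[x, y], continuous abspow}.
    by apply: derivable_within_continuous => z _; have [] := dG z.
  move: ar br; rewrite !ler_norml => /andP[ar1 ar2] /andP[br1 br2].
  have [ab|ba|<-] := ltgtP a b; last first.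
  - by exists a; rewrite !subrr normr0 mulr0 ler_norml ar1.
  - have [c] := MVT ba (fun x _ => dG x) (@cG b a).
    rewrite in_itv/= => /andP[bc ca] E; exists c; split.
    + by rewrite ler_norml; apply/andP; split; lra.
    + by rewrite !ler0_norm; lra.
    + by rewrite -[LHS]opprB E; ring.
  - have [c] := MVT ab (fun x _ => dG x) (@cG a b).
    rewrite in_itv/= => /andP[bc ca] E; exists c; split => //.
    + by rewrite ler_norml; apply/andP; split; lra.
    + by rewrite !ger0_norm; lra.
have [c [cr ca ->]] := mv.
rewrite -mulrBl -mulrBr normrM (normrM (p + 2)) (ger0_norm p2) -[(b - a) ^+
  2]real_normK ?num_real//.
rewrite [leRHS](_ : _ = (p + 2) * ((p + 1) * r `^ p * `|b - a|) * `|b - a|);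
  last by ring.
rewrite ler_wpM2r// ler_wpM2l//.
apply: le_trans (oddpow_lip cr ar) _; rewrite ler_wpM2l// mulr_ge0 ?powR_ge0//.
by move: p0; lra.
Qed.

(** Whichever of |a| and |b| is the larger bounds the product by its own power. *)
Lemma oddpow_young a b : `|oddpow a * b| <= abspow a + abspow b.
Proof.
have [ba|/ltW ab] := leP `|b| `|a|.
  apply: le_trans (_ : _ <= abspow a) _; last by rewrite lerDl abspow_ge0.
  rewrite abspow_sqr /oddpow !normrM ger0_norm ?powR_ge0// -mulrA ler_wpM2l
    ?powR_ge0//.
  by rewrite -[a ^+ 2]real_normK ?num_real// expr2 ler_wpM2l.
apply: le_trans (_ : _ <= abspow b) _; last by rewrite lerDr abspow_ge0.
rewrite abspow_sqr /oddpow !normrM ger0_norm ?powR_ge0// -mulrA.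
rewrite -[b ^+ 2]real_normK ?num_real// expr2 ler_pM ?powR_ge0 ?mulr_ge0//.
- exact: le_powp.
- by rewrite ler_wpM2r.
Qed.

Definition clamp r u := Num.max (- r) (Num.min u r).

Lemma clamp_id r u : `|u| <= r -> clamp r u = u.
Proof. by rewrite ler_norml /clamp => /andP[h1 h2]; rewrite (min_l h2) max_r. Qed.

Lemma norm_clamp r u : 0 <= r -> `|clamp r u| <= r.
Proof.
move=> r0; rewrite /clamp ler_norml le_max lexx /= ge_max ge_min lexx orbT andbT.
by lra.
Qed.

Lemma clamp_lip r u v : `|clamp r u - clamp r v| <= `|u - v|.
Proof.
rewrite /clamp; have := ler_norm (u - v); have := ler_norm (v - u);
  rewrite (distrC v u) => h1 h2.
case: (leP u r) => ur; case: (leP v r) => vr; rewrite ?subrr ?normr0//;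
 [case: (leP (- r) u) => ru; case: (leP (- r) v) => rv
 |case: (leP (- r) u) => ru; case: (leP (- r) r) => rv
 |case: (leP (- r) r) => ru; case: (leP (- r) v) => rv];
 rewrite ?subrr ?normr0// ler_norml; apply/andP; split; lra.
Qed.

End PowerNonlinearity.

(** * The power as an operator on l^2 *)

Section Superposition.
Context {R : realType} {T : choiceType}.
Variable p : R.
Hypothesis p0 : 0 < p.
Local Notation V := (l2 R T).
Implicit Types (x y : V) (r : R).

Lemma sqsumm_dom (f : T -> R) (K : R) y :
  (forall n, `|f n| <= K * `|y n|) -> sqsumm f.
Proof.
move=> fy; apply: (@summ_le _ _ _ (fun n => K ^+ 2 * y n ^+ 2));
  last exact/summZ/l2P.
move=> n; rewrite normrX -[y n ^+ 2]real_normK ?num_real// -exprMn.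
by rewrite ler_pXn2r// nnegrE// (le_trans _ (fy n)).
Qed.

Lemma norm_dom x y (K : R) : 0 <= K -> (forall n, `|x n| <= K * `|y n|) -> `|x| <=
  K * `|y|.
Proof.
move=> K0 xy; rewrite -(@ler_pXn2r _ 2)// ?nnegrE ?mulr_ge0// exprMn !normrE_sqr.
rewrite -tsumZ; last exact: l2P.
apply: le_tsum => [||n]; [exact: l2P|exact/summZ/l2P|].
rewrite -[x n ^+ 2]real_normK ?num_real// -[y n ^+ 2]real_normK ?num_real// -exprMn.
by rewrite ler_pXn2r// nnegrE// (le_trans _ (xy n)).
Qed.

Definition nonlin x : V := mkl2 (fun n => oddpow p (x n)).

(** On a lattice the coordinates are bounded by the l^2 norm, so the power of [x] is dominated by a
    multiple of [x], whatever the exponent. *)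
Lemma nonlinE x n : nonlin x n = oddpow p (x n).
Proof.
rewrite mkl2E//; apply: (@sqsumm_dom _ (`|x| `^ p) x) => m.
by apply: oddpow_bound => //; exact: coord_le.
Qed.

Lemma nonlin_lip x y r : `|x| <= r -> `|y| <= r ->
  `|nonlin x - nonlin y| <= (p + 1) * r `^ p * `|x - y|.
Proof.
move=> xr yr; apply: norm_dom => [|n]; first by rewrite mulr_ge0 ?powR_ge0//;
  move: p0; lra.
by rewrite !l2B !nonlinE; apply: oddpow_lip => //; apply: le_trans (coord_le _ _) _.
Qed.

(** Clamping each coordinate, and not the norm, keeps the operator pointwise and makes it globally
    Lipschitz; on the ball of radius [r] nothing is changed, since coordinates are bounded by the
    norm. *)
Definition nonlin_trunc r x : V := mkl2 (fun n => oddpow p (clamp r (x n))).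

Let nonlin_trunc_lip0 r (a b : R) : 0 <= r ->
  `|oddpow p (clamp r a) - oddpow p (clamp r b)| <= (p + 1) * r `^ p * `|a - b|.
Proof.
move=> r0; apply: le_trans (oddpow_lip p0 (norm_clamp a r0) (norm_clamp b r0)) _.
by rewrite ler_wpM2l ?clamp_lip// mulr_ge0 ?powR_ge0//; move: p0; lra.
Qed.

Lemma nonlin_truncE r x n : 0 <= r -> nonlin_trunc r x n = oddpow p (clamp r (x n)).
Proof.
move=> r0; rewrite mkl2E//; apply: (@sqsumm_dom _ ((p + 1) * r `^ p) x) => m.
have := nonlin_trunc_lip0 (x m) 0 r0; rewrite subr0.
by rewrite (@clamp_id _ r 0) ?normr0// oddpow0 subr0.
Qed.

Lemma nonlin_trunc_lip r x y : 0 <= r ->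
  `|nonlin_trunc r x - nonlin_trunc r y| <= (p + 1) * r `^ p * `|x - y|.
Proof.
move=> r0; apply: norm_dom => [|n]; first by rewrite mulr_ge0 ?powR_ge0//;
  move: p0; lra.
by rewrite !l2B !nonlin_truncE//; exact: nonlin_trunc_lip0.
Qed.

Lemma nonlin_trunc_id r x : `|x| <= r -> nonlin_trunc r x = nonlin x.
Proof.
move=> xr; apply: l2_ext => n; rewrite nonlin_truncE ?nonlinE ?(le_trans _ xr)//.
by rewrite clamp_id// (le_trans (coord_le _ _)).
Qed.

Definition potential x : R := tsum (fun n => abspow p (x n)).

Lemma summ_potential x : summ (fun n => abspow p (x n)).
Proof.
apply: (@summ_le _ _ _ (fun n => `|x| `^ p * x n ^+ 2)); last exact/summZ/l2P.
move=> n; rewrite ger0_norm ?abspow_ge0// abspow_sqr// ler_wpM2r ?sqr_ge0//.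
by apply: le_powp => //; exact: coord_le.
Qed.

Lemma potential_ge0 x : 0 <= potential x.
Proof. by apply: tsum_ge0 => n; exact: abspow_ge0. Qed.

Lemma dot_nonlin x : dot x (nonlin x) = potential x.
Proof. by congr tsum; apply/funext => n; rewrite nonlinE abspowE// mulrC. Qed.

Lemma potential_taylor x y r : `|x| <= r -> `|y| <= r ->
  `|potential y - potential x - (p + 2) * dot (nonlin x) (y - x)| <=
    (p + 2) * ((p + 1) * r `^ p) * `|y - x| ^+ 2.
Proof.
move=> xr yr.
have sd := summ_dot (nonlin x) (y - x).
rewrite /potential -tsumB; [|exact: summ_potential|exact: summ_potential].
rewrite /dot -tsumZ// -tsumB; [|by apply: summB; exact: summ_potential|exact: summZ].
rewrite normrE_sqr -tsumZ; last exact: l2P.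
have s1 : summ (fun n => abspow p (y n) - abspow p (x n) - (p + 2) * (nonlin x n *
  (y - x) n)).
  by apply: summB; [apply: summB; exact: summ_potential|exact: summZ].
apply: le_trans (normr_tsum s1) _; apply: le_tsum => [||n].
- exact: summ_norm.
- exact/summZ/l2P.
rewrite nonlinE l2B mulrA.
by apply: abspow_taylor => //; apply: le_trans (coord_le _ _) _.
Qed.

Lemma is_derive_potential (u : R -> V) (t : R) (w : V) : is_derive t 1 u w ->
  is_derive t 1 (fun s => potential (u s)) ((p + 2) * dot (nonlin (u t)) w).
Proof.
move=> du; have lip := is_derive_lip du; have cu := is_derive_cont du.
have /is_derive_epsP de : is_derive t 1 (fun s => dot (nonlin (u t)) (u s)) (dot
  (nonlin (u t)) w).
  apply: (@is_derive_lin _ _ _ (dot (nonlin (u t))) `|nonlin (u t)|) du.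
  - by move=> x y; rewrite dotBr.
  - by move=> a x; rewrite dotZr.
  - by move=> x; exact: normr_dot.
apply/is_derive_epsP => e e0.
pose r := `|u t| + 1.
(* The constant of the quadratic Taylor remainder on the ball of radius [r], which contains [u s]
   for s near t. *)
pose K := (p + 2) * ((p + 1) * r `^ p).
have K0 : 0 <= K by rewrite /K !mulr_ge0 ?powR_ge0//; move: p0; lra.
pose L := `|w| + 1.
have L0 : 0 <= L by rewrite addr_ge0.
have p2 : 0 < p + 2 by move: p0; lra.
pose e1 := e / 2 / (p + 2).
have e10 : 0 < e1 by rewrite !divr_gt0.
pose d := e / 2 / (K * L ^+ 2 + 1).
have KL : 0 < K * L ^+ 2 + 1 by rewrite ltr_wpDl// mulr_ge0// exprn_ge0.
have d0 : 0 < d by rewrite !divr_gt0.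
near=> s.
have hl : `|u s - u t| <= L * `|s - t| by near: s; exact: lip.
have hd : `|dot (nonlin (u t)) (u s) - dot (nonlin (u t)) (u t) - (s - t) *: dot
  (nonlin (u t)) w|
    <= e1 * `|s - t| by near: s; exact: de.
have sd : `|s - t| <= d by near: s; exists d => //= s /=; rewrite distrC; exact: ltW.
have us : `|u s| <= r.
  have : `|u t - u s| < 1 by near: s; move/cvgrPdist_lt: cu; exact.
  by move=> h; rewrite -[u s](subrK (u t)) (le_trans (ler_normD _ _))// addrC
    lerD2l distrC ltW.
have ut : `|u t| <= r by rewrite lerDl.
have ht := potential_taylor ut us.
have hq : K * `|u s - u t| ^+ 2 <= e / 2 * `|s - t|.
  apply: (@le_trans _ _ (K * (L * `|s - t|) ^+ 2)).
    by rewrite ler_wpM2l// ler_pXn2r// nnegrE// mulr_ge0.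
  rewrite exprMn (_ : _ * _ = K * L ^+ 2 * `|s - t| * `|s - t|); last by ring.
  rewrite ler_wpM2r//; apply: le_trans (ler_wpM2l _ sd) _;
    first by rewrite mulr_ge0// exprn_ge0.
  rewrite /d mulrA ler_pdivrMr// mulrC ler_wpM2l//; first by rewrite divr_ge0// ltW.
  by rewrite lerDl.
rewrite (_ : _ - _ = (potential (u s) - potential (u t) - (p + 2) * dot (nonlin (u
  t)) (u s - u t))
  + (p + 2) * (dot (nonlin (u t)) (u s) - dot (nonlin (u t)) (u t) - (s - t) *: dot
    (nonlin (u t)) w)); last first.
  by rewrite dotBr !scaleRE; ring.
apply: le_trans (ler_normD _ _) _.
rewrite [leRHS](_ : _ = e / 2 * `|s - t| + e / 2 * `|s - t|); last by field.
apply: lerD; first exact: le_trans ht hq.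
rewrite normrM (gtr0_norm p2); apply: le_trans (ler_wpM2l (ltW p2) hd) _.
rewrite le_eqVlt; apply/orP; left; apply/eqP; rewrite /e1; field.
by rewrite gt_eqF.
Unshelve. all: by end_near. Qed.

End Superposition.

(** * Energy identities *)

(* The infimum of the times at which [y > rho] can be neither positive, by
   continuity from the left, nor before the end of the interval, by continuity
   from the right and the hypothesis. *)
Lemma continuous_bootstrap (R : realType) (y : R -> R) (b rho r : R) :
  {within `[0, b], continuous y} -> rho < r -> y 0 < r ->
  (forall t : R, 0 <= t <= b -> (forall s : R, 0 <= s <= t -> y s < r) -> y t <=
    rho) ->
  forall t : R, 0 <= t <= b -> y t <= rho.
Proof.
move=> cy rhor y0 H t1 t1b; rewrite leNgt; apply/negP => yt1.
pose B := [set t | 0 <= t <= b /\ rho < y t].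
have Bt1 : B t1 by [].
have lbB : lbound B 0 by move=> t [/andP[]].
have iB : has_inf B by split; [exists t1|exists 0].
pose tau := inf B.
have tau0 : 0 <= tau by apply: lb_le_inf => //; exists t1.
have taut1 : tau <= t1 by apply: ge_inf => //; exists 0.
have taub : tau <= b by apply: le_trans taut1 _; case/andP: t1b.
have before (s : R) : 0 <= s -> s < tau -> y s <= rho.
  move=> s0 st; rewrite leNgt; apply/negP => ys.
  have : tau <= s.
    apply: ge_inf; first by exists 0.
    by split => //; rewrite s0 (le_trans (ltW st)).
  by rewrite leNgt st.
have near_tau (e : R) : 0 < e -> exists2 d : R, 0 < d &
    forall s : R, 0 <= s <= b -> `|tau - s| < d -> `|y tau - y s| < e.
  move=> e0; have taui : tau \in `[0, b] by rewrite in_itv/= tau0.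
  have := cy tau => /cvgrPdist_lt /(_ e e0).
  rewrite /prop_near1 /nbhs /= /nbhs_subspace ifT; last by rewrite inE.
  rewrite /within /= => -[d /= d0 D]; exists d => // s sb ts.
  by apply: D => //; rewrite /= in_itv.
have ytau : y tau <= rho.
  move: tau0; rewrite le_eqVlt => /predU1P[tau0|tau0].
    rewrite -tau0; apply: H; first by rewrite lexx tau0 taub.
    by move=> s; rewrite -eq_le => /eqP <-.
  rewrite leNgt; apply/negP => yt.
  have [|d d0 D] := near_tau (y tau - rho); first by rewrite subr_gt0.
  pose s := Num.max 0 (tau - d / 2).
  have s0 : 0 <= s by rewrite /s le_max lexx.
  have st : s < tau by rewrite /s gt_max tau0/=; lra.
  have := D s; rewrite s0 (le_trans (ltW st) taub) => /(_ isT).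
  rewrite gtr0_norm ?subr_gt0//.
  have sd : tau - s < d.
    have : tau - d / 2 <= s by rewrite /s le_max lexx orbT.
    lra.
  move=> /(_ sd); have := before s s0 st.
  have := ler_norm (y tau - y s); lra.
have [|d d0 D] := near_tau (r - y tau); first by rewrite subr_gt0 (le_lt_trans ytau).
have [t Bt tt] := inf_adherent d0 iB.
have [/andP[t0 tb] yt] := Bt.
have taut : tau <= t by apply: ge_inf; [exists 0|].
move: yt; rewrite ltNge => /negP; apply.
apply: H; first by rewrite t0.
move=> s /andP[s0 st]; have [stau|taus] := ltP s tau.
  exact: le_lt_trans (before s s0 stau) rhor.
have := D s; rewrite s0 (le_trans st tb) => /(_ isT).
rewrite distrC ger0_norm ?subr_ge0//.
have sd : s - tau < d by move: tt; rewrite -/tau; lra.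
move=> /(_ sd); rewrite distrC; have := ler_norm (y s - y tau); lra.
Qed.

Lemma sum_normsq_continuous (R : realType) (W W' : normedModType R) (n : nat)
  (G : 'I_n -> W -> W') : (forall k, continuous (G k)) ->
  continuous (fun x => \sum_(k < n) `|G k x| ^+ 2).
Proof.
move=> cG x; apply: cvg_big => [|k _]; first exact: add_continuous.
under eq_fun do rewrite expr2; rewrite expr2.
by apply: cvgM; apply: cvg_norm; exact: cG.
Qed.

Lemma loc_lip_continuous (R : realType) (W W' : normedModType R) (f : W -> W')
  (K : W -> R) : (forall x y, `|y - x| < 1 -> `|f y - f x| <= K x * `|y - x|) ->
  continuous f.
Proof.
move=> fK x; apply/cvgrPdist_lt => e e0.
have K1 : 0 < `|K x| + 1 by rewrite ltr_pwDr.
have : \forall y \near x, `|x - y| < Num.min 1 (e / (`|K x| + 1)).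
  have /cvgrPdist_lt := @cvg_id _ (nbhs x); apply.
  by rewrite lt_min ltr01 divr_gt0.
apply: filterS => y; rewrite lt_min => /andP[y1 ye].
rewrite distrC; rewrite distrC in y1.
apply: le_lt_trans (fK _ _ y1) _; move: ye; rewrite ltr_pdivlMr// mulrC distrC.
apply: le_lt_trans; rewrite ler_wpM2r// (le_trans (ler_norm _))//.
by rewrite lerDl.
Qed.

Section Energy.
Context {R : realType} {N : nat}.
Local Notation Z := 'rV[int]_N.
Local Notation V := (l2 R 'rV[int]_N).
Variables (nu p : R).
Hypotheses (nu0 : 0 < nu) (p0 : 0 < p).
Implicit Types (x y : V).

Definition ham x y : R :=
  2^-1 * `|y| ^+ 2 + 2^-1 * gradsq x - (p + 2)^-1 * potential p x.

Definition lyap x y : R := nu / 2 * `|x| ^+ 2 + dot x y + 3 / nu * ham x y.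

(** The Nehari functional: the derivative at [x], in the direction [x], of the static part of
    [ham]. *)
Definition nehari x : R := gradsq x - potential p x.

Lemma is_derive_normsq (u : R -> V) (t : R) (w : V) : is_derive t 1 u w ->
  is_derive t 1 (fun s => `|u s| ^+ 2) (2 * dot (u t) w).
Proof.
move=> du; have := is_derive_dot du du; under eq_fun do rewrite dotxx.
by move/is_derive_eq; apply; rewrite (dotC w); ring.
Qed.

Section Derivatives.
Variables (phi v : R -> V) (t : R).
Hypothesis dphi : is_derive t 1 phi (v t).
Hypothesis dv : is_derive t 1 v (- nu *: v t + lap (phi t) + nonlin p (phi t)).

Let pairing x : dot x (- nu *: v t + lap (phi t) + nonlin p (phi t)) =
  - nu * dot x (v t) + dot (lap (phi t)) x + dot x (nonlin p (phi t)).
Proof. by rewrite !dotDr dotZr (dotC x (lap _)). Qed.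

Lemma is_derive_ham :
  is_derive t 1 (fun s => ham (phi s) (v s)) (- nu * `|v t| ^+ 2).
Proof.
have p2 : p + 2 != 0 by rewrite gt_eqF//; move: p0; lra.
have d1 := is_derive_mull 2^-1 (is_derive_normsq dv).
have d2 := is_derive_mull 2^-1 (is_derive_gradsq dphi).
have d3 := is_derive_mull (p + 2)^-1 (is_derive_potential p0 dphi).
have := is_derive_sub (is_derive_add d1 d2) d3.
move/is_derive_eq; apply; rewrite pairing dotxx (dotC (v t) (nonlin _ _)).
by field.
Qed.

(** The term [nu / 2 * |x|^2] cancels the damping in the derivative of the pairing, which leaves
    |v|^2 - nehari; the coefficient [3 / nu] of [ham] contributes -3 |v|^2. *)
Lemma is_derive_lyap :
  is_derive t 1 (fun s => lyap (phi s) (v s)) (- 2 * `|v t| ^+ 2 - nehari (phi t)).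
Proof.
have d1 := is_derive_mull (nu / 2) (is_derive_normsq dphi).
have d2 := is_derive_dot dphi dv.
have d3 := is_derive_mull (3 / nu) is_derive_ham.
have := is_derive_add (is_derive_add d1 d2) d3.
move/is_derive_eq; apply; rewrite pairing dotxx dot_nonlin// /nehari.
have -> : dot (lap (phi t)) (phi t) = - gradsq (phi t).
  by rewrite dot_lap; congr (- _); apply: eq_bigr => k _; rewrite dotxx.
by field; rewrite gt_eqF.
Qed.

End Derivatives.

(** Where [nehari] is nonnegative, the potential is at most [gradsq], and the indefinite energy
    becomes coercive. *)
Lemma ham_lower x y : 0 <= nehari x ->
  2^-1 * `|y| ^+ 2 + (2^-1 - (p + 2)^-1) * gradsq x <= ham x y.
Proof.
rewrite /nehari subr_ge0 => pot_le; rewrite /ham mulrBl addrA lerD2l lerN2.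
by rewrite ler_wpM2l// invr_ge0; move: p0; lra.
Qed.

Lemma kappa_bounds : 0 < 2^-1 - (p + 2)^-1 <= 2^-1.
Proof.
have p2 : 0 < p + 2 by move: p0; lra.
have : 0 < (p + 2)^-1 by rewrite invr_gt0.
have : (p + 2)^-1 < 2^-1 by rewrite ltf_pV2 ?posrE//; move: p0; lra.
by move=> h1 h2; apply/andP; split; lra.
Qed.

Lemma lyap_lower x y : 0 <= nehari x -> nu / 4 * `|x| ^+ 2 <= lyap x y.
Proof.
move=> I0; have h := ham_lower y I0; have /andP[k0 _] := kappa_bounds.
have g0 : 0 <= (2^-1 - (p + 2)^-1) * gradsq x by rewrite mulr_ge0 ?gradsq_ge0// ltW.
have hy : 2^-1 * `|y| ^+ 2 <= ham x y by apply: le_trans h; rewrite lerDl.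
have n3 : 3 / nu * (2^-1 * `|y| ^+ 2) <= 3 / nu * ham x y by rewrite ler_wpM2l//
  divr_ge0// ltW.
have cs : - (`|x| * `|y|) <= dot x y by rewrite lerNl -dotNl (le_trans (dot_le _
  _))// normrN.
(* Half of the term in |x|^2 pays for the pairing; the other half of the cost, |y|^2 / nu, is below
   the 3/2 |y|^2 / nu supplied by [ham]. *)
have amgm : `|x| * `|y| <= nu / 4 * `|x| ^+ 2 + nu^-1 * `|y| ^+ 2.
  rewrite -subr_ge0 (_ : _ - _ = nu^-1 * (nu / 2 * `|x| - `|y|) ^+ 2);
    last by field; rewrite gt_eqF.
  by rewrite mulr_ge0 ?sqr_ge0// invr_ge0 ltW.
have e : 3 / nu * (2^-1 * `|y| ^+ 2) = nu^-1 * `|y| ^+ 2 + 2^-1 * (nu^-1 * `|y| ^+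
  2).
  by field; rewrite gt_eqF.
have q0 : 0 <= nu^-1 * `|y| ^+ 2 by rewrite mulr_ge0 ?sqr_ge0// invr_ge0 ltW.
rewrite /lyap; lra.
Qed.

(** * Continuity of the energies along curves *)

Lemma continuous_normsq (u : R -> V) (D : set R) : {within D, continuous u} ->
  {within D, continuous (fun s => `|u s| ^+ 2)}.
Proof.
move=> cu s; under eq_fun do rewrite expr2.
by apply: cvgM; apply: cvg_norm; exact: cu.
Qed.

Lemma gradsq_continuous : continuous (@gradsq R N).
Proof.
apply: (@sum_normsq_continuous _ _ _ _ (@grad R N)) => k.
by apply: (@lip_continuous _ _ _ _ 2) => a b; rewrite -gradB norm_grad.
Qed.

Lemma potential_continuous : continuous (@potential R Z p).
Proof.
pose r x := `|x| + 1.
pose K x := (p + 2) * `|nonlin p x| + (p + 2) * ((p + 1) * r x `^ p).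
have p2 : 0 <= p + 2 by move: p0; lra.
apply: (@loc_lip_continuous _ _ _ _ K) => x y y1.
have xr : `|x| <= r x by rewrite lerDl.
have yr : `|y| <= r x.
  by rewrite -[y](subrK x) (le_trans (ler_normD _ _))// addrC lerD2l ltW.
have ht := potential_taylor p0 xr yr.
have hd : `|(p + 2) * dot (nonlin p x) (y - x)| <= (p + 2) * `|nonlin p x| * `|y -
  x|.
  by rewrite normrM (ger0_norm p2) -mulrA ler_wpM2l// normr_dot.
rewrite -[potential p y - potential p x](subrK ((p + 2) * dot (nonlin p x) (y - x))).
apply: le_trans (ler_normD _ _) _; rewrite /K [leRHS]mulrDl [leRHS]addrC.
apply: lerD; last exact: hd.
apply: le_trans ht _; rewrite ler_wpM2l ?mulr_ge0 ?powR_ge0//; first by move: p0;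
  lra.
by rewrite expr2 ler_piMl// ltW.
Qed.

Lemma continuous_ham (u w : R -> V) (D : set R) : {within D, continuous u} ->
  {within D, continuous w} -> {within D, continuous (fun s => ham (u s) (w s))}.
Proof.
move=> cu cw s; apply: cvgB; first apply: cvgD.
- by apply: cvgM; [exact: cvg_cst|exact: (continuous_normsq cw)].
- apply: cvgM; first exact: cvg_cst.
  by apply: (@cvg_comp _ _ _ u (@gradsq R N)); [exact: cu|exact: gradsq_continuous].
- apply: cvgM; first exact: cvg_cst.
  by apply: (@cvg_comp _ _ _ u (@potential R Z p));
    [exact: cu|exact: potential_continuous].
Qed.

(** Polarization reduces continuity of the scalar product along curves to continuity of the norm. *)
Lemma dot_polar x y : dot x y = 4^-1 * (`|x + y| ^+ 2 - `|x - y| ^+ 2).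
Proof. by rewrite -!dotxx !(dotDl, dotDr, dotNl, dotNr) (dotC y x); field. Qed.

Lemma continuous_dot (u w : R -> V) (D : set R) : {within D, continuous u} ->
  {within D, continuous w} -> {within D, continuous (fun s => dot (u s) (w s))}.
Proof.
move=> cu cw s; under eq_fun do rewrite dot_polar.
apply: cvgM; first exact: cvg_cst.
apply: cvgB.
  by apply: (@continuous_normsq (fun s => u s + w s)) => x; apply: cvgD;
    [exact: cu|exact: cw].
by apply: (@continuous_normsq (fun s => u s - w s)) => x; apply: cvgB;
  [exact: cu|exact: cw].
Qed.

Lemma continuous_lyap (u w : R -> V) (D : set R) : {within D, continuous u} ->
  {within D, continuous w} -> {within D, continuous (fun s => lyap (u s) (w s))}.
Proof.
move=> cu cw s; apply: cvgD; first apply: cvgD.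
- by apply: cvgM; [exact: cvg_cst|exact: (continuous_normsq cu)].
- exact: (continuous_dot cu cw).
- by apply: cvgM; [exact: cvg_cst|exact: (continuous_ham cu cw)].
Qed.

End Energy.

(** * A priori bound, uniqueness and global existence *)

Section Flow.
Context {R : realType} {N : nat}.
Local Notation Z := 'rV[int]_N.
Local Notation V := (l2 R 'rV[int]_N).
Variables (nu p : R).
Hypotheses (nu0 : 0 < nu) (p0 : 0 < p).
Implicit Types (x y : V) (phi v h : R -> V) (b t : R).

(** The force [h] is left free so that one a priori bound serves both the given solution and the
    truncated equation. The derivatives are asked in the open interval only, which is all that a
    solution offers at time 0. *)
Definition damped b phi v h :=
  [/\ {within `[0, b], continuous phi}, {within `[0, b], continuous v} &
    forall t, 0 < t < b -> is_derive t 1 phi (v t) /\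
      is_derive t 1 v (- nu *: v t + lap (phi t) + h t)].

Lemma damped_sub b b' phi v h : b' <= b -> damped b phi v h -> damped b' phi v h.
Proof.
move=> bb [cp cv dpv].
have sub : `[0, b'] `<=` `[0, b].
  by move=> t; rewrite /= !in_itv/= => /andP[-> /le_trans]; apply.
split; [exact: continuous_subspaceW cp|exact: continuous_subspaceW cv|].
by move=> t /andP[t0 tb]; apply: dpv; rewrite t0 (lt_le_trans tb).
Qed.

Lemma lyap_nonincreasing b phi v h : 0 <= b -> damped b phi v h ->
  (forall t, 0 < t < b -> h t = nonlin p (phi t)) ->
  (forall t, 0 < t < b -> 0 <= nehari p (phi t)) ->
  lyap nu p (phi b) (v b) <= lyap nu p (phi 0) (v 0).
Proof.
move=> b0 [cp cv dpv] hE I0.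
apply: (@le0_derive_le _ (fun t => lyap nu p (phi t) (v t))
  (fun t => - 2 * `|v t| ^+ 2 - nehari p (phi t)) _ _ b0).
- exact: continuous_lyap.
- move=> t tb; have [d1 d2] := dpv t tb; rewrite (hE t tb) in d2.
  exact: is_derive_lyap.
- move=> t tb; have := I0 t tb; have := sqr_ge0 `|v t|; lra.
Qed.

Lemma gronwall0 b (D D' : R -> R) (K : R) : 0 <= b ->
  {within `[0, b], continuous D} ->
  (forall t, 0 < t < b -> is_derive t 1 D (D' t)) ->
  (forall t, 0 < t < b -> D' t <= K * D t) -> D 0 = 0 -> D b <= 0.
Proof.
move=> b0 cD dD DK D00.
have dE t : is_derive t 1 (fun s => expR (- K * s)) (- K * expR (- K * t)) by
  exact: is_derive_exp.
have : expR (- K * b) * D b <= expR (- K * 0) * D 0.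
  apply: (@le0_derive_le _ (fun t => expR (- K * t) * D t)
    (fun t => expR (- K * t) * (D' t - K * D t)) _ _ b0).
  - move=> t; apply: cvgM; last exact: cD.
    by apply: continuous_subspaceT => s; exact: is_derive_cont (dE s).
  - move=> t tb; have := is_deriveM (dE t) (dD t tb).
    by move/is_derive_eq; apply; rewrite !scaleRE; ring.
  - by move=> t tb; rewrite mulr_ge0_le0 ?expR_ge0// subr_le0 DK.
by rewrite D00 mulr0 pmulr_rle0// expR_gt0.
Qed.

Lemma damped_unique b phi v phi2 v2 (r : R) : 0 <= b ->
  damped b phi v (fun t => nonlin p (phi t)) ->
  damped b phi2 v2 (fun t => nonlin p (phi2 t)) ->
  (forall t, 0 < t < b -> `|phi t| <= r /\ `|phi2 t| <= r) ->
  phi 0 = phi2 0 -> v 0 = v2 0 -> phi b = phi2 b /\ v b = v2 b.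
Proof.
move=> b0 [cp cv d1] [cp2 cv2 d2] bd p00 v00.
pose d t := phi t - phi2 t; pose e t := v t - v2 t.
pose g t := nonlin p (phi t) - nonlin p (phi2 t).
(* The three summands of [K] come from the pairings of the two differences with each other, through
   [lap], and through the nonlinearity; each uses 2 |d| |e| <= D. The damping term has the
   favourable sign. *)
pose L := (p + 1) * r `^ p; pose K := 1 + 4 * N%:R + L.
pose D t := `|d t| ^+ 2 + `|e t| ^+ 2.
have : D b <= 0.
  apply: (@gronwall0 b D (fun t => 2 * dot (d t) (e t) +
      2 * dot (e t) (- nu *: e t + lap (d t) + g t)) K b0).
  - move=> t; apply: cvgD.
      by apply: (continuous_normsq (u := d)) => s; apply: cvgB;
        [exact: cp|exact: cp2].
    by apply: (continuous_normsq (u := e)) => s; apply: cvgB; [exact: cv|exact: cv2].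
  - move=> t tb; have [dp1 dv1] := d1 t tb; have [dp2 dv2] := d2 t tb.
    have dd := is_derive_sub dp1 dp2; have de := is_derive_sub dv1 dv2.
    apply: is_derive_add; first exact: is_derive_normsq dd.
    have := is_derive_normsq de; move/is_derive_eq; apply.
    congr (2 * dot _ _); rewrite /e /d /g lapB; apply: l2_ext => n.
    by rewrite !l2E; ring.
  - move=> t tb; have [b1 b2] := bd t tb.
    rewrite (dotDr _ (g t)) (dotDr (- nu *: e t)) dotZr dotxx.
    have h1 := dot_le (d t) (e t).
    have h2 : dot (e t) (lap (d t)) <= `|e t| * (4 * N%:R * `|d t|).
      by apply: le_trans (dot_le _ _) _; rewrite ler_wpM2l// norm_lap.
    have h3 : dot (e t) (g t) <= `|e t| * (L * `|d t|).
      by apply: le_trans (dot_le _ _) _; rewrite ler_wpM2l// nonlin_lip.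
    have L0 : 0 <= L by rewrite mulr_ge0 ?powR_ge0//; move: p0; lra.
    have N0 : 0 <= N%:R :> R by [].
    have q : 2 * (`|d t| * `|e t|) <= D t.
      by have := sqr_ge0 (`|d t| - `|e t|); rewrite /D sqrrB; lra.
    have KE : K * D t = D t + 4 * N%:R * D t + L * D t by rewrite /K; ring.
    have n0 : 0 <= nu * `|e t| ^+ 2 by rewrite mulr_ge0 ?sqr_ge0// ltW.
    have q2 : 4 * N%:R * (2 * (`|d t| * `|e t|)) <= 4 * N%:R * D t by rewrite
      ler_wpM2l// mulr_ge0.
    have q3 : L * (2 * (`|d t| * `|e t|)) <= L * D t by rewrite ler_wpM2l.
    rewrite KE; lra.
  - by rewrite /D /d /e p00 v00 !subrr !normr0 !expr0n/= addr0.
rewrite /D => Db; have := sqr_ge0 `|d b|; have := sqr_ge0 `|e b| => e2 d2'.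
have /eqP : `|d b| ^+ 2 = 0 by lra.
have /eqP : `|e b| ^+ 2 = 0 by lra.
by rewrite !sqrf_eq0 !normr_eq0 !subr_eq0 => /eqP-> /eqP->.
Qed.

(** * Consequences of the Gagliardo-Nirenberg inequality *)

Section GagliardoNirenberg.
Variables (C sigma r : R).
Hypotheses (C0 : 0 < C) (s0 : 0 < sigma) (Cr : C * r `^ sigma = 1).
Hypothesis SGN : forall x, potential p x <= C * (`|x| ^+ 2) `^ sigma * gradsq x.

(** Two radii are used: the threshold [r], which gives mere nonnegativity, and in the decay part a
    smaller one, which gives a positive multiple of [gradsq]. *)
Lemma nehari_lower x (rho : R) : `|x| ^+ 2 <= rho ->
  (1 - C * rho `^ sigma) * gradsq x <= nehari p x.
Proof.
move=> xr; rewrite /nehari mulrBl mul1r lerD2l lerN2.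
apply: le_trans (SGN x) _; rewrite ler_wpM2r ?gradsq_ge0// ler_wpM2l ?(ltW C0)//.
by apply: ge0_ler_powR; rewrite ?nnegrE ?(ltW s0)// ?sqr_ge0// (le_trans _ xr)
  ?sqr_ge0.
Qed.

Lemma nehari_ge0 x : `|x| ^+ 2 <= r -> 0 <= nehari p x.
Proof. by move/nehari_lower; rewrite Cr subrr mul0r. Qed.

(** Nonnegativity of [nehari] at time 0 starts the continuity argument, as [lyap_lower] then bounds
    the initial norm. The force needs to be the true one only while the squared norm is below [r], a
    condition met by the truncated force. *)
Lemma a_priori b phi v h : damped b phi v h ->
  0 <= nehari p (phi 0) -> 4 / nu * lyap nu p (phi 0) (v 0) < r ->
  (forall t, 0 <= t <= b -> `|phi t| ^+ 2 < r -> h t = nonlin p (phi t)) ->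
  forall t, 0 <= t <= b -> `|phi t| ^+ 2 <= 4 / nu * lyap nu p (phi 0) (v 0).
Proof.
move=> dp I0 rhor hE; set rho := 4 / nu * _ in rhor *.
have n4 : 0 < 4 / nu by rewrite divr_gt0.
have lower t : 0 <= nehari p (phi t) ->
    lyap nu p (phi t) (v t) <= lyap nu p (phi 0) (v 0) -> `|phi t| ^+ 2 <= rho.
  move=> It le; have := le_trans (lyap_lower nu0 p0 (v t) It) le.
  rewrite -(ler_pM2l n4) -/rho (_ : 4 / nu * (_ * _) = `|phi t| ^+ 2)//.
  by field; rewrite gt_eqF.
have cphi : {within `[0, b], continuous (fun t => `|phi t| ^+ 2)}.
  by apply: continuous_normsq; case: dp.
apply: (continuous_bootstrap cphi rhor); first exact: le_lt_trans (lower 0 I0 (lexx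
  _)) rhor.
move=> t /andP[t0 tb] small; apply: lower.
  by apply: nehari_ge0; rewrite ltW// small// t0 lexx.
apply: (lyap_nonincreasing t0 (damped_sub tb dp)) => s /andP[/ltW s0' /ltW st].
- by apply: hE; rewrite ?s0' ?(le_trans st)// small// s0'.
- by apply: nehari_ge0; rewrite ltW// small// s0'.
Qed.

Lemma global_solution x0 y0 : 0 <= nehari p x0 -> 4 / nu * lyap nu p x0 y0 < r ->
  exists phi v, [/\ phi 0 = x0, v 0 = y0 & forall t, 0 <= t ->
    [/\ is_derive t 1 phi (v t),
        is_derive t 1 v (- nu *: v t + lap (phi t) + nonlin p (phi t)) &
        `|phi t| ^+ 2 <= 4 / nu * lyap nu p x0 y0]].
Proof.
(* The bound concerns the squared norm, so truncating at the square root of [r] has no effect on the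
   orbit. *)
move=> I0 rhor; pose r' := Num.sqrt r; pose Lg := (p + 1) * r' `^ p.
have r'0 : 0 <= r' by exact: sqrtr_ge0.
pose g x y := - nu *: y + lap x + nonlin_trunc p r' x.
have Lg0 : 0 <= Lg by rewrite mulr_ge0 ?powR_ge0//; move: p0; lra.
have N0 : 0 <= N%:R :> R by [].
pose L := 1 + nu + 4 * N%:R + Lg.
have L1 : 1 <= L by rewrite /L; move: nu0; lra.
have gL x y x' y' : `|g x y - g x' y'| <= L * (`|x - x'| + `|y - y'|).
  have -> : g x y - g x' y' = - nu *: (y - y') + lap (x - x') + (nonlin_trunc p r'
    x - nonlin_trunc p r' x').
    by rewrite lapB /g; apply: l2_ext => n; rewrite !l2E; ring.
  apply: le_trans (ler_normD _ _) _.
  apply: le_trans (lerD (ler_normD _ _) (nonlin_trunc_lip p0 x x' r'0)) _.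
  rewrite normrZ normrN (gtr0_norm nu0) -/Lg.
  apply: le_trans (lerD (lerD (lexx _) (norm_lap _)) (lexx _)) _.
  have a1 : 0 <= `|x - x'| by []; have a2 : 0 <= `|y - y'| by [].
  have m1 : 0 <= nu * `|x - x'| by rewrite mulr_ge0// ltW.
  have m2 : 0 <= N%:R * `|y - y'| by rewrite mulr_ge0.
  have m3 : 0 <= Lg * `|y - y'| by rewrite mulr_ge0.
  have -> : L * (`|x - x'| + `|y - y'|) = `|x - x'| + `|y - y'| + nu * `|x - x'| +
    nu * `|y - y'|
     + 4 * N%:R * `|x - x'| + 4 * (N%:R * `|y - y'|) + Lg * `|x - x'| + Lg * `|y -
       y'|.
    by rewrite /L; ring.
  lra.
have [phi [v [phi00 v00 dpv]]] := picard x0 y0 L1 gL.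
have dp b : damped b phi v (fun t => nonlin_trunc p r' (phi t)).
  split.
  - by apply: derivable_within_continuous => t; rewrite in_itv/= => /andP[t0 _];
    have [[]] := dpv t t0.
  - by apply: derivable_within_continuous => t; rewrite in_itv/= => /andP[t0 _];
    have [_ []] := dpv t t0.
  - by move=> t /andP[/ltW t0 _]; exact: dpv.
have gE t : `|phi t| ^+ 2 < r -> nonlin_trunc p r' (phi t) = nonlin p (phi t).
  by move=> pr; apply: nonlin_trunc_id => //; rewrite -(normr_id (phi t))
    -sqrtr_sqr ler_wsqrtr// ltW.
have bd t : 0 <= t -> `|phi t| ^+ 2 <= 4 / nu * lyap nu p x0 y0.
  move=> t0; rewrite -phi00 -v00; apply: (a_priori (dp t));
    rewrite ?phi00 ?v00// ?t0 ?lexx//.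
  by move=> s _; exact: gE.
exists phi, v; split => // t t0; have [d1 d2] := dpv t t0; split => //;
  last exact: bd.
by rewrite -gE//; exact: le_lt_trans (bd t t0) rhor.
Qed.

End GagliardoNirenberg.
End Flow.

(** * Decay *)

(** Young's inequality is applied to each pair of translates, and the sums of powers are invariant
    under translation: every pair has the same bound, hence so has the mean, uniformly in [m]. *)
Lemma dot_avg_nonlin_le (R : realType) (N : nat) (p : R) (p0 : 0 < p)
  (e : 'rV[int]_N) (m : nat) (x : l2 R 'rV[int]_N) :
  dot (avg e m x) (avg e m (nonlin p x)) <= 2 * potential p x.
Proof.
have m0 : 0 < m.+1%:R :> R by rewrite ltr0n.
have sh i j : dot (shift_l2 (e *+ i) x) (shift_l2 (e *+ j) (nonlin p x)) <= 2 *
  potential p x.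
  pose f k n := abspow p (x (n + e *+ k)).
  have sf k : summ (f k).
    apply: (@summ_reindex _ _ _ (fun n => n + e *+ k) (fun n => abspow p (x n))).
      exact: bij_inj (translate_bij _).
    exact: summ_potential.
  have tf k : tsum (f k) = potential p x.
    exact: (tsum_reindex (fun n => abspow p (x n)) (translate_bij (e *+ k))).
  have -> : 2 * potential p x = tsum (f j) + tsum (f i) by rewrite !tf; ring.
  rewrite -(tsumD (sf j) (sf i)).
  apply: (le_tsum (summ_dot _ _) (summD (sf j) (sf i))) => n.
  rewrite (shiftE (e *+ i)) (shiftE (e *+ j)) (nonlinE p0) mulrC.
  apply: le_trans (ler_norm _) _; exact: oddpow_young.
rewrite /avg dotZl dotZr mulrA -invfM mulrC ler_pdivrMr ?mulr_gt0//.
rewrite dot_suml; apply: (@le_trans _ _ (\sum_(i < m.+1) \sum_(j < m.+1) 2 *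
  potential p x)).
  apply: ler_sum => i _; rewrite dotC dot_suml; apply: ler_sum => j _.
  by rewrite dotC; exact: sh.
rewrite !sumr_const !card_ord le_eqVlt; apply/orP; left; apply/eqP.
by rewrite -mulrnA -[LHS]mulr_natr natrM.
Qed.

Section Decay.
Context {R : realType} {N : nat}.
Local Notation Z := 'rV[int]_N.
Local Notation V := (l2 R 'rV[int]_N).
Variables (nu p C sigma rho : R) (k0 : 'I_N).
Hypotheses (nu0 : 0 < nu) (p0 : 0 < p) (C0 : 0 < C) (s0 : 0 < sigma).
Hypothesis Crho : C * rho `^ sigma < 1.
Hypothesis SGN : forall x : V, potential p x <= C * (`|x| ^+ 2) `^ sigma * gradsq x.
Variables (phi v : R -> V).
Implicit Types s t u eps eta : R.
Hypothesis dphi : forall t, 0 <= t -> is_derive t 1 phi (v t).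
Hypothesis dv : forall t, 0 <= t ->
  is_derive t 1 v (- nu *: v t + lap (phi t) + nonlin p (phi t)).
Hypothesis phi_rho : forall t, 0 <= t -> `|phi t| ^+ 2 <= rho.

Let c : R := 1 - C * rho `^ sigma.
Let e t : R := `|v t| ^+ 2 + gradsq (phi t).
Let F t : R := lyap nu p (phi t) (v t).
Let H t : R := ham p (phi t) (v t).
Let kappa : R := 2^-1 - (p + 2)^-1.

Let c0 : 0 < c. Proof. by rewrite subr_gt0. Qed.

Let c1 : c <= 1. Proof. by rewrite gerBl mulr_ge0 ?powR_ge0// ltW. Qed.

Let e0 t : 0 <= e t. Proof. by rewrite addr_ge0 ?sqr_ge0 ?gradsq_ge0. Qed.

Let nehari_c t : 0 <= t -> c * gradsq (phi t) <= nehari p (phi t).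
Proof. by move=> /phi_rho /(nehari_lower C0 s0 SGN). Qed.

Let neh0 t : 0 <= t -> 0 <= nehari p (phi t).
Proof. by move=> /nehari_c; apply: le_trans; rewrite mulr_ge0 ?gradsq_ge0// ltW. Qed.

Let decr (G G' : R -> R) (s t : R) : 0 <= s -> s <= t ->
  (forall u, 0 <= u -> is_derive u 1 G (G' u)) -> (forall u, 0 <= u -> G' u <= 0)
    -> G t <= G s.
Proof.
move=> s_0 st dG G0; apply: (@le0_derive_le _ G G' s t st).
- apply: derivable_within_continuous => u; rewrite in_itv/= => /andP[su _].
  by have [] := dG u (le_trans s_0 su).
- by move=> u /andP[/ltW su _]; apply: dG; exact: le_trans su.
- by move=> u /andP[/ltW su _]; apply: G0; exact: le_trans su.
Qed.

Let dF t : 0 <= t -> is_derive t 1 F (- 2 * `|v t| ^+ 2 - nehari p (phi t)).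
Proof. by move=> t0; apply: is_derive_lyap => //; [exact: dphi|exact: dv]. Qed.

Let dH t : 0 <= t -> is_derive t 1 H (- nu * `|v t| ^+ 2).
Proof. by move=> t0; apply: is_derive_ham => //; [exact: dphi|exact: dv]. Qed.

Let F'_le t : 0 <= t -> - 2 * `|v t| ^+ 2 - nehari p (phi t) <= - (c * e t).
Proof.
move=> t0; have := nehari_c t0; have : c * `|v t| ^+ 2 <= 2 * `|v t| ^+ 2.
  by rewrite ler_wpM2r ?sqr_ge0//; have := c1; lra.
rewrite /e mulrDr; lra.
Qed.

Let H_lower t : 0 <= t -> kappa * e t <= H t.
Proof.
move=> t0; apply: le_trans (ham_lower p0 (v t) (neh0 t0)).
rewrite /e mulrDr lerD2r ler_wpM2r ?sqr_ge0//.
by have /andP[_] := kappa_bounds p0.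
Qed.

Let H_upper t : H t <= 2^-1 * e t.
Proof.
rewrite /H /ham /e mulrDr gerBl mulr_ge0 ?potential_ge0// invr_ge0; move: p0; lra.
Qed.

Let F0 t : 0 <= t -> 0 <= F t.
Proof.
move=> t0; apply: le_trans (lyap_lower nu0 p0 (v t) (neh0 t0)).
by rewrite mulr_ge0 ?sqr_ge0// divr_ge0// ltW.
Qed.

Let F_decr s t : 0 <= s -> s <= t -> F t <= F s.
Proof.
move=> s_0 st; apply: (decr s_0 st dF) => u u0; apply: le_trans (F'_le u0) _.
by rewrite oppr_le0 mulr_ge0 ?e0// ltW.
Qed.

(** The function F + c t H is nonincreasing: its derivative contains c H, at most c e / 2, which is
    absorbed by F' <= - c e. Hence c t H is at most F 0, and H dominates [kappa * e]. *)
Let e_decay t : 0 < t -> e t <= F 0 / (c * kappa) / t.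
Proof.
move=> t0; have t0' := ltW t0.
have /andP[k_0 _] := kappa_bounds p0.
have : F t + c * (t * H t) <= F 0 + c * (0 * H 0).
  apply: (@decr (fun t => F t + c * (t * H t)) (fun t =>
     (- 2 * `|v t| ^+ 2 - nehari p (phi t)) + c * (H t + t * (- nu * `|v t| ^+ 2)))
       0 t (lexx 0) t0').
  - move=> u u0; apply: is_derive_add; first exact: dF.
    apply: is_derive_mull.
    have := is_deriveM (is_derive_id u (1 : R)) (dH u0).
    by move/is_derive_eq; apply; rewrite !scaleRE; ring.
  - move=> u u0; have := F'_le u0.
    have : c * H u <= c * (2^-1 * e u) by rewrite ler_wpM2l ?H_upper// ltW.
    have : 0 <= c * (u * (nu * `|v u| ^+ 2)).
      by rewrite !mulr_ge0 ?sqr_ge0// ltW.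
    have : 0 <= c * e u by rewrite mulr_ge0 ?e0// ltW.
    lra.
rewrite mul0r mulr0 addr0 => le.
have h : c * (t * (kappa * e t)) <= F 0.
  apply: le_trans le; apply: le_trans (_ : c * (t * H t) <= _);
    last by rewrite lerDr F0.
  by rewrite ler_wpM2l ?(ltW c0)// ler_wpM2l// H_lower.
rewrite ler_pdivlMr// ler_pdivlMr ?mulr_gt0//.
by apply: le_trans h; rewrite le_eqVlt; apply/orP; left; apply/eqP; rewrite /kappa;
  ring.
Qed.

Section Averaged.
Variable m : nat.
Let Q : V -> V := avg (unit_vec k0) m.
Let M t : R := nu / 2 * `|Q (phi t)| ^+ 2 + dot (Q (phi t)) (Q (v t)).

(** [M] is [lyap] without its [ham] term, taken along the averaged curve. Since [Q] commutes with
    [lap], that curve solves the damped equation with averaged force and no commutator appears. *)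
Let dM t : 0 <= t -> is_derive t 1 M
  (`|Q (v t)| ^+ 2 - gradsq (Q (phi t)) + dot (Q (phi t)) (Q (nonlin p (phi t)))).
Proof.
move=> t0.
have dQ (u : R -> V) (w : V) : is_derive t 1 u w -> is_derive t 1 (fun s => Q (u
  s)) (Q w).
  apply: (@is_derive_lin _ _ _ Q 1) => [x y|a x|x]; [exact: avgB|exact: avgZ|].
  by rewrite mul1r norm_avg.
have dQp := dQ _ _ (dphi t0); have dQv := dQ _ _ (dv t0).
have := is_derive_add (is_derive_mull (nu / 2) (is_derive_normsq dQp))
  (is_derive_dot dQp dQv).
move/is_derive_eq; apply.
have gE : dot (lap (Q (phi t))) (Q (phi t)) = - gradsq (Q (phi t)).
  by rewrite dot_lap; congr (- _); apply: eq_bigr => k _; rewrite dotxx.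
have -> : Q (- nu *: v t + lap (phi t) + nonlin p (phi t)) =
    - nu *: Q (v t) + lap (Q (phi t)) + Q (nonlin p (phi t)).
  by rewrite /Q !avgD avgZ avg_lap.
rewrite (dotDr _ (Q (nonlin p (phi t)))) (dotDr (- nu *: Q (v t))) (dotZr _ (Q (v
  t))).
by rewrite (dotC _ (lap _)) gE (dotxx (Q (v t))); field.
Qed.

(** The derivative of [M] is at most |v|^2 plus twice the potential, hence at most [2 * e], while
    that of [2 / c * F] is at most [- 2 * e]. *)
Let M_decr s t : 0 <= s -> s <= t -> M t + 2 / c * F t <= M s + 2 / c * F s.
Proof.
move=> s_0 st; have c2 : 0 <= 2 / c by rewrite divr_ge0// ltW.
apply: (@decr (fun t => M t + 2 / c * F t) (fun t => (`|Q (v t)| ^+ 2 - gradsq (Q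
  (phi t))
    + dot (Q (phi t)) (Q (nonlin p (phi t)))) + 2 / c * (- 2 * `|v t| ^+ 2 - nehari
      p (phi t))) s t s_0 st).
- by move=> u u0; apply: is_derive_add; [exact: dM|apply: is_derive_mull; exact: dF].
- move=> u u0.
  have h1 : `|Q (v u)| ^+ 2 <= `|v u| ^+ 2 by rewrite ler_pXn2r ?nnegrE// norm_avg.
  have h2 := gradsq_ge0 (Q (phi u)).
  have h3 := dot_avg_nonlin_le p0 (unit_vec k0) m (phi u).
  have h4 : potential p (phi u) <= gradsq (phi u) by have := neh0 u0;
    rewrite /nehari subr_ge0.
  have h5 := ler_wpM2l c2 (F'_le u0).
  have h6 : 2 / c * - (c * e u) = - (2 * e u) by field; rewrite gt_eqF.
  have h7 := sqr_ge0 `|v u|.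
  rewrite h6 in h5; rewrite -/Q in h3; rewrite /e in h5; lra.
Qed.

Let M_upper t : 0 <= t ->
  M t <= `|Q (phi t)| * (nu / 2 * `|phi t| + `|v t|).
Proof.
move=> t0; rewrite /M mulrDr; apply: lerD.
  rewrite expr2 mulrCA ler_wpM2l// ler_wpM2l ?norm_avg//.
  by rewrite divr_ge0// ltW.
by apply: le_trans (dot_le _ _) _; rewrite ler_wpM2l// norm_avg.
Qed.

(* Averaging m translates changes [phi] by at most [m] times its gradient,
   which is negligible at large times. *)
Let M_lower t (eta : R) : 0 <= t -> 0 <= eta -> eta <= 1 -> e t <= eta ^+ 2 ->
  F t <= M t + (nu * Num.sqrt rho * m.+1%:R + 2 * Num.sqrt rho + 3 / nu) * eta.
Proof.
move=> t0 eta0 eta1 et.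
set B : R := Num.sqrt rho.
have B0 : 0 <= B by exact: sqrtr_ge0.
have pB : `|phi t| <= B by rewrite -(normr_id (phi t)) -sqrtr_sqr ler_wsqrtr//
  phi_rho.
have vE : `|v t| <= eta.
  rewrite -(@ler_pXn2r _ 2)// ?nnegrE//; apply: le_trans et.
  by rewrite lerDl gradsq_ge0.
have gE : `|grad k0 (phi t)| <= eta.
  rewrite -(@ler_pXn2r _ 2)// ?nnegrE//; apply: le_trans et.
  by apply: le_trans (norm_grad_le _ _) _; rewrite lerDr sqr_ge0.
have dQ : `|phi t - Q (phi t)| <= m.+1%:R * eta.
  by apply: le_trans (norm_sub_avg _ _ _) _; rewrite ler_wpM2l.
have qn : `|phi t| - `|Q (phi t)| <= m.+1%:R * eta.
  by apply: le_trans dQ; exact: lerB_dist.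
have Qp : `|Q (phi t)| <= `|phi t| by exact: norm_avg.
have sq : `|phi t| ^+ 2 - `|Q (phi t)| ^+ 2 <= 2 * B * (m.+1%:R * eta).
  have B2 : `|phi t| + `|Q (phi t)| <= 2 * B by lra.
  rewrite subr_sqr mulrC; apply: ler_pM B2 qn; first exact: addr_ge0.
  by rewrite subr_ge0.
have d1 : dot (phi t) (v t) <= B * eta by apply: le_trans (dot_le _ _) _;
  exact: ler_pM.
have d2 : - dot (Q (phi t)) (Q (v t)) <= B * eta.
  rewrite -dotNl; apply: le_trans (dot_le _ _) _; rewrite normrN;
    apply: ler_pM => //.
    exact: le_trans Qp pB.
  exact: le_trans (norm_avg _ _ _) vE.
have hH : 3 / nu * H t <= 3 / nu * eta.
  rewrite ler_wpM2l ?divr_ge0 ?(ltW nu0)//; apply: le_trans (H_upper t) _.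
  have : eta ^+ 2 <= eta by rewrite expr2 ler_piMr.
  have := e0 t; lra.
have sq2 := ler_wpM2l (ltW (divr_gt0 nu0 (ltr0Sn R 1))) sq.
rewrite /F /M /lyap -/(H t).
have -> : (nu * B * m.+1%:R + 2 * B + 3 / nu) * eta =
  nu / 2 * (2 * B * (m.+1%:R * eta)) + B * eta + B * eta + 3 / nu * eta by field;
    rewrite gt_eqF.
lra.
Qed.

(** The two times are kept apart: the first term is made small by [m] at fixed [s], the last one by
    [eta] at fixed [m], at the price of a late [t]. *)
Lemma lyap_average_bound s t (eta : R) : 0 <= s -> s <= t -> 0 <= eta -> eta <= 1 ->
  e t <= eta ^+ 2 ->
  F t + 2 / c * F t <= `|Q (phi s)| * (nu / 2 * `|phi s| + `|v s|) + 2 / c * F s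
    + (nu * Num.sqrt rho * m.+1%:R + 2 * Num.sqrt rho + 3 / nu) * eta.
Proof.
move=> s_0 st eta0 eta1 et.
have := M_lower (le_trans s_0 st) eta0 eta1 et; have := M_decr s_0 st.
have := M_upper s_0; lra.
Qed.

End Averaged.

Let unit_free (j : nat) : unit_vec k0 *+ j = 0 -> j = 0%N.
Proof.
move=> /matrixP /(_ 0 k0); rewrite mxE.
have -> : (unit_vec k0 *+ j) 0 k0 = (j%:R : int) by rewrite /unit_vec mulmxnE mxE
  !eqxx.
by move/eqP; rewrite pnatr_eq0 => /eqP.
Qed.

(** A single time is enough, because [F] is nonincreasing. *)
Let lyap_cvg0 (eps : R) : 0 < eps -> exists2 t, 0 <= t & F t < eps.
Proof.
move=> eps0; apply: contrapT => nF.
have Feps t : 0 <= t -> eps <= F t.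
  by move=> t0; rewrite leNgt; apply/negP => Ft; apply: nF; exists t.
pose A := [set F t | t in [set t | 0 <= t]].
have iA : has_inf A.
  split; first by exists (F 0), 0 => /=.
  by exists 0 => _ [t t0 <-]; exact: F0.
(* With this gap to the infimum, 2/c (F s - F t) is at most eps/4. The two other contributions are
   also at most eps/4 each, so F t is at most 3/4 eps. *)
have c8 : 0 < c * eps / 8 by rewrite !mulr_gt0 ?invr_gt0.
have [_ [s s_0 <-] Fs] := inf_adherent c8 iA.
have infF t : 0 <= t -> inf A <= F t.
  by move=> t0; apply: ge_inf; [case: iA|exists t].
pose P := nu / 2 * `|phi s| + `|v s| + 1.
have P0 : 0 < P by rewrite ltr_wpDl// addr_ge0// mulr_ge0// divr_ge0// ltW.
have [m Qm] := avg_cvg0 (phi s) unit_free (divr_gt0 (divr_gt0 eps0 (ltr0Sn R 3)) P0).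
pose E := nu * Num.sqrt rho * m.+1%:R + 2 * Num.sqrt rho + 3 / nu + 1.
have E0' : 0 <= nu * Num.sqrt rho * m.+1%:R + 2 * Num.sqrt rho + 3 / nu.
  by rewrite !addr_ge0 ?mulr_ge0 ?sqrtr_ge0 ?invr_ge0// ltW.
have E0 : 0 < E by rewrite ltr_wpDl.
pose eta := Num.min 1 (eps / 4 / E).
have eta0 : 0 < eta by rewrite lt_min ltr01 !divr_gt0.
have eta1 : eta <= 1 by rewrite ge_min lexx.
have etaE : eta * E <= eps / 4 by rewrite -ler_pdivlMr// ge_min lexx orbT.
pose K := F 0 / (c * kappa).
have K0 : 0 <= K.
  have /andP[k_0 _] := kappa_bounds p0.
  by rewrite divr_ge0 ?F0// mulr_ge0 ?(ltW c0)// ltW.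
(* The first entry puts [t] after [s] and makes it positive; the second brings the O(1/t) bound on
   [e t] below [eta ^+ 2]. *)
pose t := Num.max (s + 1) (K / eta ^+ 2).
have st : s <= t by rewrite le_max lerDl ler01.
have t0 : 0 < t by rewrite lt_max ltr_wpDl.
have et : e t <= eta ^+ 2.
  apply: le_trans (e_decay t0) _; rewrite -/K ler_pdivrMr// mulrC -ler_pdivrMr
    ?exprn_gt0//.
  by rewrite le_max lexx orbT.
have := lyap_average_bound m s_0 st (ltW eta0) eta1 et.
have h1 : `|avg (unit_vec k0) m (phi s)| * (nu / 2 * `|phi s| + `|v s|) <= eps / 4.
  apply: le_trans (_ : _ <= `|avg (unit_vec k0) m (phi s)| * P) _.
    by rewrite ler_wpM2l// lerDl.
  by rewrite -ler_pdivlMr// ltW.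
have h2 : (nu * Num.sqrt rho * m.+1%:R + 2 * Num.sqrt rho + 3 / nu) * eta <= eps / 4.
  apply: le_trans etaE; rewrite mulrC ler_wpM2l ?(ltW eta0)//.
  by rewrite lerDl.
have h3 : 2 / c * F s - 2 / c * F t <= eps / 4.
  rewrite -mulrBr mulrAC ler_pdivrMr//.
  have := infF t (ltW t0); move: Fs; lra.
have := Feps t (ltW t0); lra.
Qed.

Theorem decay (eps : R) : 0 < eps ->
  exists2 t0, 0 <= t0 & forall t, t0 <= t -> `|phi t| <= eps.
Proof.
move=> eps0.
have e2 : 0 < nu / 4 * eps ^+ 2 by rewrite mulr_gt0 ?divr_gt0 ?exprn_gt0.
have [t0 t00 Ft] := lyap_cvg0 e2.
exists t0 => // t tt0; have t_0 := le_trans t00 tt0.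
have := lyap_lower nu0 p0 (v t) (neh0 t_0).
have := F_decr t00 tt0 => h1 h2.
have : nu / 4 * `|phi t| ^+ 2 <= nu / 4 * eps ^+ 2.
  by apply: le_trans h2 (le_trans h1 (ltW Ft)).
by rewrite ler_pM2l ?divr_gt0// ler_pXn2r// nnegrE// ltW.
Qed.

End Decay.

(** * Translation to sequences *)

Lemma near_itvoo (R : realType) (a b t : R) : a < t < b -> \forall s \near t, a < s
  < b.
Proof.
move=> tab; have /near_in_itvoo : t \in `]a, b[ by rewrite in_itv.
by apply: filterS => s; rewrite in_itv.
Qed.

Lemma within_itv_continuous (R : realType) (W : normedModType R) (f : R -> W) (a b
  t : R) :
  a < t < b -> {within `[a, b], continuous f} -> {for t, continuous f}.
Proof.
move=> tab /subspace_continuousP cf; have /andP[/ltW at_ /ltW tb] := tab.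
have tI : `[a, b]%classic t by rewrite /= in_itv/= at_.
have /cvgrPdist_lt ct := cf t tI.
apply/cvgrPdist_lt => e e0; apply: filterS2 (near_itvoo tab) (ct e e0) => s
  /andP[/ltW as_ /ltW sb]; apply.
by rewrite /= in_itv/= as_.
Qed.

Section Transfer.
Context {R : realType} {N : nat}.
Local Notation Z := 'rV[int]_N.
Local Notation V := (l2 R 'rV[int]_N).
Implicit Types (D : set R) (u v : R -> Z -> R) (U W : R -> V).

Lemma lsum_sqr (x : V) : lsum (fun n => `|x n| `^ 2) = `|x| ^+ 2.
Proof.
rewrite normrE_sqr /lsum -/(tsum _); congr tsum; apply/funext => n.
by rewrite powR_mulrn// real_normK// num_real.
Qed.

Lemma lpnorm_powR (q : R) (x : V) : 0 < q -> 
  lpnorm (q + 2) x `^ (q + 2) = potential q x.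
Proof.
move=> q0; rewrite /lpnorm -powRrM mulVf ?powRr1//; first exact: (potential_ge0 q x).
by rewrite gt_eqF// addr_gt0.
Qed.

Lemma lp2_l2 (x : V) : lp 2 x.
Proof. exact/lp2E/l2P. Qed.

Lemma rho0E (nu sigma : R) (x y : V) : 0 < nu ->
  rho0 nu sigma x y = 4 / nu * lyap nu (2 * sigma) x y.
Proof.
move=> nu0; rewrite /rho0 /energy0 /lyap /ham !l2normE grad_normsqE.
rewrite -[l2dot x y]/(dot x y) -[lsum _]/(potential (2 * sigma) x).
by move: (2 * sigma + 2)^-1 => z; field; rewrite gt_eqF.
Qed.

Lemma l2normB (x y : V) : l2norm (l2fun x - l2fun y) = `|x - y|.
Proof. exact: (l2normE (x - y)). Qed.

Lemma l2norm_quotient (a : R) (x y z : V) :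
  l2norm (a *: (l2fun x - l2fun y) - l2fun z) = `|a *: (x - y) - z|.
Proof. exact: (l2normE (a *: (x - y) - z)). Qed.

Lemma l2_cont_of D u U : (forall t, D t -> u t = U t) ->
  (forall t, D t -> {for t, continuous U}) -> l2_cont D u.
Proof.
move=> uU cU; split=> [t Dt|t Dt]; first by rewrite uU//; exact: lp2_l2.
apply/cvgrPdist_lt => e e0; have /cvgrPdist_lt /(_ e e0) [d /= d0 H] := cU t Dt.
exists d => // s /= sd Ds; rewrite sub0r normrN !uU//.
by rewrite l2normB normr_id distrC; exact: H.
Qed.

(** [u] may differ from [U] outside [D]: at a boundary point, the two-sided derivative of [U]
    provides the one-sided derivative of [u]. *)
Lemma l2_deriv_of D u v U W : (forall t, D t -> u t = U t) ->
  (forall t, D t -> v t = W t) ->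
  (forall t, D t -> is_derive t 1 U (W t)) -> l2_deriv D u v.
Proof.
move=> uU vW dU; split=> [t Dt|t Dt|t Dt]; [by rewrite uU//; exact: lp2_l2|
  by rewrite vW//; exact: lp2_l2|].
apply/cvgrPdist_le => e e0.
have /is_derive_epsP /(_ e e0) [d /= d0 H] := dU t Dt.
exists d => // s /= sd st Ds; rewrite sub0r normrN !uU// vW//.
have st0 : s - t != 0 by rewrite subr_eq0.
rewrite l2norm_quotient normr_id.
rewrite (_ : _ - W t = (s - t)^-1 *: (U s - U t - (s - t) *: W t)); last first.
  by rewrite [RHS]scalerBr scalerA mulVf// scale1r.
by rewrite normrZ normfV mulrC ler_pdivrMr ?normr_gt0//; exact: H.
Qed.

Lemma within_continuous_of D (A : set R) u U : A `<=` D ->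
  (forall t, D t -> u t = U t) -> l2_cont D u -> {within A, continuous U}.
Proof.
move=> AD uU [_ cu]; apply/subspace_continuousP => t At.
apply/cvgrPdist_lt => e e0.
have /cvgrPdist_lt /(_ e e0) [d /= d0 H] := cu t (AD t At).
exists d => // s /= sd As; have := H s sd (AD s As).
rewrite sub0r normrN !uU//; [|exact: AD|exact: AD].
by rewrite l2normB normr_id distrC.
Qed.

Lemma nonlin_continuous (p : R) : 0 < p -> continuous (@nonlin R Z p).
Proof.
move=> p0; apply: (@loc_lip_continuous _ _ _ _ (fun x => (p + 1) * (`|x| + 1) `^
  p)) => x y y1.
apply: nonlin_lip => //; last by rewrite lerDl.
by rewrite -[y](subrK x) (le_trans (ler_normD _ _))// addrC lerD2l ltW.
Qed.

Lemma lap_continuous : continuous (@lap R N).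
Proof.
by apply: (@lip_continuous _ _ _ _ (4 * N%:R)) => x y; rewrite -lapB norm_lap.
Qed.

Lemma field_continuous (nu p : R) (U W : R -> V) (t : R) : 0 < p ->
  {for t, continuous U} -> {for t, continuous W} ->
  {for t, continuous (fun s => - nu *: W s + lap (U s) + nonlin p (U s))}.
Proof.
move=> p0 cU cW; apply: cvgD; first apply: cvgD.
- by apply: cvgZr; exact: cW.
- by apply: (@cvg_comp _ _ _ U (@lap R N)); [exact: cU|exact: lap_continuous].
- by apply: (@cvg_comp _ _ _ U (@nonlin R Z p));
  [exact: cU|exact: nonlin_continuous].
Qed.

Section Solutions.
Variables (nu sigma : R) (x0 y0 : V).
Hypothesis s0 : 0 < sigma.
Let p := 2 * sigma.
Let p0 : 0 < p. Proof. by rewrite mulr_gt0. Qed.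

Lemma lifetime_pinfty : @lifetime R +oo%E = [set t | 0 <= t].
Proof. by apply/seteqP; split => t /=; [case|split => //; rewrite ltry]. Qed.

Lemma solution_of (phi v : R -> V) : phi 0 = x0 -> v 0 = y0 ->
  (forall t : R, 0 <= t -> is_derive t 1 phi (v t)) ->
  (forall t : R, 0 <= t -> is_derive t 1 v (- nu *: v t + lap (phi t) + nonlin p
    (phi t))) ->
  dKG_solution nu sigma x0 y0 +oo%E phi v.
Proof.
move=> phi0E v0E dphi dv; split => //; rewrite ?lifetime_pinfty.
- split; apply: l2_cont_of => // t t0; apply: is_derive_cont.
    exact: dphi.
  exact: dv.
- by rewrite phi0E v0E.
- move=> t n /ltW t0 _; split; first exact/is_derive_coord/dphi.
  exists ((- nu *: v t + lap (phi t) + nonlin p (phi t)) n); split;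
    first exact/is_derive_coord/dv.
  by rewrite !l2E nonlinE// -lapE /oddpow /p; ring.
Qed.

(** A solution is l^2-continuous but differentiable only site by site. The velocity and the
    right-hand side of the equation are then l^2-continuous, which is what [is_derive_l2] asks
    for. *)
Lemma damped_of_solution (T : \bar R) (phi v : R -> Z -> R) (b : R) :
  dKG_solution nu sigma x0 y0 T phi v -> 0 <= b -> (b%:E < T)%E ->
  damped nu b (fun t => mkl2 (phi t)) (fun t => mkl2 (v t))
    (fun t => nonlin p (mkl2 (phi t))).
Proof.
move=> [T0 [cphi cv] _ eqs] b0 bT.
set U := fun t => mkl2 (phi t); set W := fun t => mkl2 (v t).
have PE t : lifetime T t -> phi t = U t.
  by move=> Tt; exact: (esym (mkl2E (proj1 (lp2E _) (cphi.1 t Tt)))).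
have WE t : lifetime T t -> v t = W t.
  by move=> Tt; exact: (esym (mkl2E (proj1 (lp2E _) (cv.1 t Tt)))).
have sub : `[0, b] `<=` lifetime T.
  move=> t; rewrite /= in_itv/= => /andP[t0 tb]; split => //.
  by apply: le_lt_trans bT; rewrite lee_fin.
have cU : {within `[0, b], continuous U} by exact: within_continuous_of PE cphi.
have cW : {within `[0, b], continuous W} by exact: within_continuous_of WE cv.
split => // t tb.
have inner (s : R) : 0 < s < b -> lifetime T s.
  by move=> /andP[/ltW s_0 /ltW sb]; apply: sub; rewrite /= in_itv/= s_0.
have [cU' cW'] : {for t, continuous U} /\ {for t, continuous W}.
  by split; [exact: within_itv_continuous tb cU|exact: within_itv_continuous tb cW].
have dU (s : R) n : 0 < s < b -> is_derive s (1 : R) (fun s => U s n : R) (W s n).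
  move=> sb; have Ts := inner s sb; rewrite -(WE s Ts).
  have [d _] := eqs s n (proj1 (andP sb)) Ts.2.
  apply: is_derive_restr d; apply: filterS (near_itvoo sb) => x /inner Tx.
  by rewrite (PE x Tx).
have dW (s : R) n : 0 < s < b -> is_derive s (1 : R) (fun s => W s n : R)
    ((- nu *: W s + lap (U s) + nonlin p (U s)) n).
  move=> sb; have Ts := inner s sb.
  have [_ [a [d E]]] := eqs s n (proj1 (andP sb)) Ts.2.
  (* The equation identifies the acceleration at the site with a coordinate of the right-hand
     side. *)
  rewrite (_ : (_ + nonlin p (U s)) n = a).
    apply: is_derive_restr d; apply: filterS (near_itvoo sb) => x /inner Tx.
    by rewrite (WE x Tx).
  move: E; rewrite (PE s Ts) (WE s Ts) -lapE !l2E nonlinE// /oddpow -/p => /eqP.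
  rewrite !subr_eq add0r => /eqP E; rewrite mulNr.
  by rewrite -[RHS](addrK (nu * W s n)) E; ring.
pose A s := - nu *: W s + lap (U s) + nonlin p (U s).
split.
  apply: (@is_derive_l2 _ _ U W) => //.
  by apply: filterS (near_itvoo tb) => s sb n; exact: dU.
apply: (@is_derive_l2 _ _ W A); last exact: field_continuous.
by apply: filterS (near_itvoo tb) => s sb n; exact: dW.
Qed.

End Solutions.
End Transfer.

Theorem theorem4p2 (R : realType) (N : nat) (hN : (1 <= N)%N)
  (nu sigma : R) (hnu : 0 < nu) (hsigma : 2 / N%:R <= sigma)
  (phi0 phi1 : 'rV[int]_N -> R) (hphi0 : lp 2 phi0) (hphi1 : lp 2 phi1)
  (C : R) (hC : 0 < C)
  (hSGN : forall psi : 'rV[int]_N -> R, lp 2 psi ->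
     lsum (fun n => `|psi n| `^ (2 * sigma + 2))
       <= C * lsum (fun n => `|psi n| `^ 2) `^ sigma * grad_normsq psi)
  (hrho : rho0 nu sigma phi0 phi1 < 1 / C `^ (1 / sigma))
  (hgrad : grad_normsq phi0
             > lpnorm (2 * sigma + 2) phi0 `^ (2 * sigma + 2))
  (T : \bar R) (phi phid : R -> 'rV[int]_N -> R)
  (hphi : dKG_maximal_solution nu sigma phi0 phi1 T phi phid) :
  [/\ T = +oo%E,
      l2_C2 [set t : R | 0 <= t] phi
    & l2norm (phi t) @[t --> +oo] --> (0 : R)].
Proof.
have s0 : 0 < sigma by apply: lt_le_trans hsigma; rewrite divr_gt0// ltr0n.
pose p := 2 * sigma; have p0 : 0 < p by rewrite mulr_gt0.
(* The squared norm at which the factor in front of [gradsq] in the Gagliardo-Nirenberg inequality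
   reaches 1. *)
pose r := 1 / C `^ (1 / sigma).
have Cs0 : 0 < C `^ (1 / sigma) by rewrite powR_gt0.
have r0 : 0 < r by rewrite divr_gt0.
have Cr : C * r `^ sigma = 1.
  rewrite /r div1r -powR_inv1 ?(ltW Cs0)// -powRrM mulN1r -powRrM.
  rewrite mulrN div1r mulVf ?gt_eqF//.
  by rewrite powR_inv1 ?(ltW hC)// divff// gt_eqF.
have [x0 x0E] : exists x : l2 R 'rV[int]_N, phi0 = x.
  by exists (mkl2 phi0); exact: (esym (mkl2E (proj1 (lp2E _) hphi0))).
have [y0 y0E] : exists x : l2 R 'rV[int]_N, phi1 = x.
  by exists (mkl2 phi1); exact: (esym (mkl2E (proj1 (lp2E _) hphi1))).
rewrite {phi0 hphi0}x0E {phi1 hphi1}y0E in hrho hgrad hphi.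
have SGN (x : l2 R 'rV[int]_N) : potential p x <= C * (`|x| ^+ 2) `^ sigma * gradsq
  x.
  by have := hSGN x (lp2_l2 x); rewrite lsum_sqr grad_normsqE.
have I0 : 0 <= nehari p x0.
  by rewrite subr_ge0 -grad_normsqE -lpnorm_powR// ltW.
have rhor : 4 / nu * lyap nu p x0 y0 < r by rewrite -rho0E.
have [P [W [P0 W0 PW]]] := global_solution hnu p0 hC s0 Cr SGN I0 rhor.
set rho := 4 / nu * lyap nu p x0 y0 in rhor PW.
have dP (t : R) : 0 <= t -> is_derive t 1 P (W t) by move=> /PW[].
have dW (t : R) : 0 <= t -> is_derive t 1 W (- nu *: W t + lap (P t) + nonlin p (P
  t)) by move=> /PW[].
have Prho (t : R) : 0 <= t -> `|P t| ^+ 2 <= rho by move=> /PW[].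
have solP := solution_of s0 P0 W0 dP dW.
have [sol max] := hphi.
have agree t : lifetime T t -> P t = phi t :> (_ -> R) /\ W t = phid t :> (_ -> R).
  move=> [t0 tT]; have [T0 [[vphi _] [vphid _]] [phi00 phid00] _] := sol.
  have dphi := damped_of_solution s0 sol t0 tT.
  have L0 : lifetime T 0 by split.
  have Lt : lifetime T t by split.
  have m0 : mkl2 (phi 0) = x0 by rewrite phi00 mkl2_val.
  have md0 : mkl2 (phid 0) = y0 by rewrite phid00 mkl2_val.
  have dPW : damped nu t P W (fun t => nonlin p (P t)).
    split.
    - by apply: derivable_within_continuous => u; rewrite in_itv/= => /andP[u0 _];
      have [] := dP u u0.
    - by apply: derivable_within_continuous => u; rewrite in_itv/= => /andP[u0 _];
      have [] := dW u u0.
    - by move=> u /andP[/ltW u0 _]; split; [exact: dP|exact: dW].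
  (* The nonlinearity is Lipschitz on balls only, so uniqueness needs a ball containing both
     solutions; the a priori bound applied to the given one provides it. *)
  have bnd (u : R) : 0 < u < t -> `|mkl2 (phi u) : l2 R 'rV[int]_N| <= Num.sqrt rho
    /\ `|P u| <= Num.sqrt rho.
    move=> /andP[/ltW u0 /ltW ut].
    have sq (x : l2 R 'rV[int]_N) : `|x| ^+ 2 <= rho -> `|x| <= Num.sqrt rho.
      by move=> h; rewrite -(normr_id x) -sqrtr_sqr ler_wsqrtr.
    split; apply: sq; last exact: Prho.
    have := a_priori hnu p0 hC s0 Cr SGN dphi; rewrite m0 md0 => H.
    by apply: (H I0 rhor) => //; rewrite u0.
  have [E1 E2] : mkl2 (phi t) = P t /\ mkl2 (phid t) = W t.
    by apply: (damped_unique hnu p0 t0 dphi dPW bnd); rewrite ?m0 ?md0.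
  rewrite -E1 -E2.
  split; [exact: (mkl2E (proj1 (lp2E _) (vphi t Lt)))|exact: (mkl2E (proj1 (lp2E _)
    (vphid t Lt)))].
have Too : T = +oo%E.
  apply/eqP; rewrite -leye_eq; apply: max solP _ => t Tt _.
  exact: agree.
have phiP (t : R) : 0 <= t -> phi t = P t.
  by move=> t0; have [] := agree t; rewrite // Too lifetime_pinfty.
split => //.
- pose A t : l2 R 'rV[int]_N := - nu *: W t + lap (P t) + nonlin p (P t).
  exists (fun t => l2fun (W t)), (fun t => l2fun (A t)); split.
  + by apply: (l2_deriv_of phiP _ dP).
  + by apply: (l2_deriv_of (U := W) (W := A)).
  + by apply: (l2_cont_of phiP) => t /dP /is_derive_cont.
  + by apply: (l2_cont_of (U := W)) => // t /dW /is_derive_cont.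
  + apply: (l2_cont_of (U := A)) => // t t0; apply: field_continuous => //.
      exact: is_derive_cont (dP t t0).
    exact: is_derive_cont (dW t t0).
(* The strict inequality assumed on [rho0] becomes the positive margin on which the decay estimates
   rest. *)
- have Crho : C * rho `^ sigma < 1.
    rewrite -Cr ltr_pM2l//; apply: gt0_ltr_powR; rewrite ?nnegrE ?(ltW r0)//.
    by have := Prho 0 (lexx 0); apply: le_trans; rewrite sqr_ge0.
  apply/cvgrPdist_le => e e0.
  have [t0 t00 Ht] := decay (Ordinal hN) hnu p0 hC s0 Crho SGN dP dW Prho e0.
  exists t0; split; first exact: num_real.
  move=> t /ltW tt0; rewrite sub0r normrN phiP ?l2normE ?normr_id; first exact: Ht.
  exact: le_trans tt0.
Qed.
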